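(* If $\Omega \in \mathcal{S}^2$ is concave, then for any integer $k \ge 1$ $$c_k(\Omega) = \max_{1 \le j \le k} \Big( \min_{p \in \bar{U}_\Omega} A_{j,k+1-j}(p) \Big).$$
   Context: All vector spaces and homology groups are over $\mathbb{Q}$. **Domains.** Let $\Sigma^2 := \{v \in (\mathbb{R}_{\ge 0})^2 \mid |v|=1\}$. $\mathcal{S}^2$ is the set of all $\Omega \subset (\mathbb{R}_{\ge 0})^2$ for which there is $r_\Omega \in C^\infty(\Sigma^2, \mathbb{R}_{>0})$ with $\Omega = \{ tz \mid 0 \le t \le r_\Omega(z),\ z \in \Sigma^2\}$. Put $U_\Omega := (\mathbb{R}_{>0})^2 \setminus \Omega$, and let $\bar{U}_\Omega$ be the closure of $U_\Omega$ in $(\mathbb{R}_{\ge 0})^2$. $\Omega$ is called concave if $U_\Omega$ is a convex subset of $\mathbb{R}^2$. **Chain complex.** Let $I := \mathbb{Z}^2 \setminus (\mathbb{Z}_{\le 0})^2$ and $S^1 = \mathbb{R}/\mathbb{Z}$. Let $e_0 \in H_0(S^1)$ be the class of a point and $e_1 \in H_1(S^1)$ the class of $[0,1] \to S^1$, $t \mapsto [t]$. Define the $\mathbb{Z}$-graded vector space $$C^\Omega_* := \bigoplus_{(m_1,m_2) \in I} C^{\mathrm{sing}}_{*+1-2(m_1+m_2)}(U_\Omega) \otimes H_*(S^1),$$ where $C^{\mathrm{sing}}_*$ is the singular chain complex; i.e. for a singular $i$-chain $\sigma$, the element $\sigma \otimes e_j$ in the $(m_1,m_2)$-summand has degree $2(m_1+m_2)-1+i+j$.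 Write $x = \sum_{(m_1,m_2) \in I,\, i \in \{0,1\}} x_{m_1,m_2,i} \otimes e_i$. For homogeneous $x$ of degree $|x|$, the boundary operator is $$(\partial x)_{m_1,m_2,0} = \partial^{\mathrm{sing}} x_{m_1,m_2,0}, \qquad (\partial x)_{m_1,m_2,1} = \partial^{\mathrm{sing}} x_{m_1,m_2,1} + (-1)^{|x|}\big(m_2\, x_{m_1+1,m_2,0} - m_1\, x_{m_1,m_2+1,0}\big)$$ for $(m_1,m_2)\in I$. **Filtration.** Let $A_{m_1,m_2}(y_1,y_2) := m_1 y_1 + m_2 y_2$. For $a \in \mathbb{R}$ let $U_\Omega(a:m_1,m_2) := \{ y \in U_\Omega \mid A_{m_1,m_2}(y) < a\}$. Let $C^{\Omega,a}_* \subset C^\Omega_*$ be the subcomplex obtained by replacing $U_\Omega$ by $U_\Omega(a:m_1,m_2)$ in the $(m_1,m_2)$-summand, and $C^{\Omega,\infty}_* := C^\Omega_*$. For $-\infty<a<b\le\infty$ put $C^{\Omega,[a,b)}_* := C^{\Omega,b}_*/C^{\Omega,a}_*$. **Capacities.** For $0<a\le\infty$ let $H^{+,a}_*(\Omega) := \varprojlim_{\delta \to 0+} H_*(C^{\Omega,[\delta,a)})$, the inverse limit along the natural maps induced by $C^{\Omega,[\delta,a)}_* \to C^{\Omega,[\delta',a)}_*$ for $\delta \le \delta'$. For $a>0$ let $(i^a_\Omega)_*: H^{+,a}_*(\Omega) \to H^{+,\infty}_*(\Omega)$ be the natural map. For an integer $k \ge 1$, $$c_k(\Omega) := \inf\{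 a>0 \mid (i^a_\Omega)_{2k+1} \ne 0\}.$$ *)

(* Defs.v *)
From HB Require Import structures.
From mathcomp.multinomials Require Import freeg.
From mathcomp Require Import all_boot all_order all_algebra.
From mathcomp Require Import all_classical all_reals all_analysis.
From mathcomp Require Import ring_quotient zify lra.

Set Implicit Arguments.
Unset Strict Implicit.
Unset Printing Implicit Defensive.

Import Order.TTheory GRing.Theory Num.Theory.
Import numFieldNormedType.Exports.

Local Open Scope classical_set_scope.
Local Open Scope ring_scope.

Section Subgroup.
Variables (V : zmodType) (S : zmodClosed V).

Record subgroup := Subgroup { subgroup_val :> V; _ : subgroup_val \in S }.

HB.instance Definition _ := [isSub for subgroup_val].
HB.instance Definition _ := [Choice of subgroup by <:].
HB.instance Definition _ := [SubChoice_isSubZmodule of subgroup by <:].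

End Subgroup.

Section SubgroupMap.
Variables (V W : zmodType) (S : zmodClosed V) (T : zmodClosed W).
Variable f : {additive V -> W}.
Variable fST : {homo f : x / x \in S >-> x \in T}.

Definition subgroup_map (x : subgroup S) : subgroup T :=
  Subgroup (fST (valP x)).

Lemma subgroup_map_is_zmod_morphism : zmod_morphism subgroup_map.
Proof. by move=> x y; apply: val_inj; rewrite /= !raddfB. Qed.

HB.instance Definition _ :=
  GRing.isZmodMorphism.Build _ _ subgroup_map subgroup_map_is_zmod_morphism.

End SubgroupMap.

Section QuotMap.
Variables (V W : zmodType) (S : zmodClosed V) (T : zmodClosed W).
Variable f : {additive V -> W}.

Definition quot_map (_ : {homo f : x / x \in S >-> x \in T})
    (c : Quotient.quot S) : Quotient.quot T :=
  \pi_(Quotient.quot T)%qT (f (repr c)).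

Variable fST : {homo f : x / x \in S >-> x \in T}.

Lemma quot_map_pi x :
  quot_map fST (\pi_(Quotient.quot S)%qT x) = \pi_(Quotient.quot T)%qT (f x).
Proof.
rewrite /quot_map; apply/eqP; rewrite -Quotient.idealrBE -raddfB; apply: fST.
by rewrite Quotient.idealrBE reprK.
Qed.

Lemma quot_map_is_zmod_morphism : zmod_morphism (quot_map fST).
Proof.
move=> x y; rewrite -[x]reprK -[y]reprK -raddfB !quot_map_pi.
by rewrite 2!raddfB.
Qed.

HB.instance Definition _ :=
  GRing.isZmodMorphism.Build _ _ (quot_map fST) quot_map_is_zmod_morphism.

End QuotMap.

(* The differential of degree -1 is stored as a family indexed by source and
   target degree, vanishing off i = j + 1, which avoids casts along the
   equation n + 1 - 1 = n. Chain groups are only required to be additive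
   groups: for the complexes of rational vector spaces below, the vanishing of
   maps in homology does not involve the scalars. *)
Record chain_complex := ChainComplex {
  cobj :> int -> zmodType;
  cdiff : forall i j, {additive cobj i -> cobj j};
  cdiff_shape : forall i j x, i != j + 1 -> cdiff i j x = 0;
  cdiff_cdiff : forall i j k x, cdiff j k (cdiff i j x) = 0 }.

Record chain_map (C D : chain_complex) := ChainMap {
  cmap :> forall n, {additive C n -> D n};
  cmapE : forall i j x, cdiff D i j (cmap i x) = cmap j (cdiff C i j x) }.

Section Homology.
Variable C : chain_complex.

Definition cycles (n : int) : {pred C n} := fun x => cdiff C n (n - 1) x == 0.

Lemma cycles_zmod_closed n : zmod_closed (@cycles n).
Proof.
split; first by apply/eqP; rewrite raddf0.
move=> x y /eqP xE /eqP yE; apply/eqP.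
by rewrite raddfB xE yE subr0.
Qed.

HB.instance Definition _ n :=
  GRing.isZmodClosed.Build (C n) (@cycles n) (cycles_zmod_closed n).

Definition boundaries (n : int) : {pred subgroup (@cycles n)} :=
  fun z => `[< exists y, cdiff C (n + 1) n y = val z >].

Lemma boundaries_zmod_closed n : zmod_closed (@boundaries n).
Proof.
split; first by apply/asboolP; exists 0; rewrite raddf0.
move=> x y /asboolP[x' xE] /asboolP[y' yE]; apply/asboolP; exists (x' - y').
by rewrite !raddfB xE yE.
Qed.

HB.instance Definition _ n :=
  GRing.isZmodClosed.Build (subgroup (@cycles n)) (@boundaries n)
    (boundaries_zmod_closed n).

Definition homology (n : int) : zmodType := Quotient.quot (@boundaries n).

End Homology.

Section HomologyMap.
Variables (C D : chain_complex) (f : chain_map C D).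

Lemma cmap_cycles n : {homo f n : x / x \in @cycles C n >-> x \in @cycles D n}.
Proof. by move=> x /eqP xE; apply/eqP; rewrite cmapE xE raddf0. Qed.

Lemma cmap_boundaries n : {homo subgroup_map (@cmap_cycles n) :
  z / z \in @boundaries C n >-> z \in @boundaries D n}.
Proof.
move=> z /asboolP[y yE]; apply/asboolP; exists (f _ y).
by rewrite cmapE yE.
Qed.

Definition homology_map n : {additive homology C n -> homology D n} :=
  quot_map (@cmap_boundaries n).

End HomologyMap.

Section QuotientComplex.
Variables (C : chain_complex) (S : forall n, zmodClosed (C n)).
Variable dS : forall i j, {homo cdiff C i j : x / x \in S i >-> x \in S j}.

Let qobj n : zmodType := Quotient.quot (S n).
Let qdiff i j : {additive qobj i -> qobj j} := quot_map (@dS i j).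

Lemma qdiff_shape i j x : i != j + 1 -> qdiff i j x = 0.
Proof.
by move=> ij; rewrite -[x]reprK [LHS]quot_map_pi cdiff_shape // raddf0.
Qed.

Lemma qdiff_qdiff i j k x : qdiff j k (qdiff i j x) = 0.
Proof.
rewrite -[x]reprK [X in qdiff _ _ X]quot_map_pi [LHS]quot_map_pi.
by rewrite cdiff_cdiff raddf0.
Qed.

Definition quotient_complex := ChainComplex qdiff_shape qdiff_qdiff.

End QuotientComplex.

Section QuotientComplexMap.
Variables (C D : chain_complex) (f : chain_map C D).
Variables (S : forall n, zmodClosed (C n)) (T : forall n, zmodClosed (D n)).
Variable dS : forall i j, {homo cdiff C i j : x / x \in S i >-> x \in S j}.
Variable dT : forall i j, {homo cdiff D i j : x / x \in T i >-> x \in T j}.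
Variable fST : forall n, {homo f n : x / x \in S n >-> x \in T n}.

Let qmap n : {additive quotient_complex dS n -> quotient_complex dT n} :=
  quot_map (@fST n).

Lemma qmapE i j x :
  cdiff (quotient_complex dT) i j (qmap i x) =
  qmap j (cdiff (quotient_complex dS) i j x).
Proof.
rewrite -[x]reprK [qmap i _]quot_map_pi [LHS]quot_map_pi.
by rewrite [X in qmap _ X]quot_map_pi [RHS]quot_map_pi cmapE.
Qed.

Definition quotient_complex_map := ChainMap qmapE.

End QuotientComplexMap.

Section SingularChains.
Variable R : realType.

Definition std_simplex n : set 'rV[R]_n.+1 :=
  [set t | (forall i, 0 <= t 0 i) /\ \sum_i t 0 i = 1].

Definition coface n (i : 'I_n.+2) (t : 'rV[R]_n.+1) : 'rV[R]_n.+2 :=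
  \row_j oapp (t 0) 0 (unlift i j).

Lemma coface_lift n i (t : 'rV[R]_n.+1) j : coface i t 0 (lift i j) = t 0 j.
Proof. by rewrite mxE liftK. Qed.

Lemma coface_id n i (t : 'rV[R]_n.+1) : coface i t 0 i = 0.
Proof. by rewrite mxE unlift_none. Qed.

Lemma std_simplex_coface n i (t : 'rV[R]_n.+1) :
  std_simplex t -> std_simplex (coface i t).
Proof.
move=> [t0 t1]; split=> [j|].
  by case: (unliftP i j) => [k|] ->; rewrite ?coface_lift ?coface_id.
rewrite (bigD1_ord i) //= coface_id add0r -t1.
by apply: eq_bigr => j _; rewrite coface_lift.
Qed.

(* The index i' with lift (lift i j) i' = i. *)
Definition face_swap n (i : 'I_n.+2) (j : 'I_n.+1) : 'I_n.+1 :=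
  odflt j (unlift (lift i j) i).

Lemma lift_face_swap n (i : 'I_n.+2) (j : 'I_n.+1) :
  lift (lift i j) (face_swap i j) = i.
Proof.
rewrite /face_swap; case: unliftP => [k //|/esym/eqP].
by rewrite (negbTE (neq_lift i j)) || rewrite eq_sym (negbTE (neq_lift i j)).
Qed.

Lemma face_swapE n (i : 'I_n.+2) (j : 'I_n.+1) :
  face_swap i j = unbump j i :> nat.
Proof.
have /(congr1 val)/(congr1 (unbump (lift i j))) /= := lift_face_swap i j.
rewrite bumpK => ->; rewrite /unbump /bump; case: (leqP i j) => ij.
  by rewrite ltnNge (leq_trans ij) ?leqnSn // ltnNge ij.
by rewrite add0n ij.
Qed.

Lemma coface_coface n (i : 'I_n.+3) (j : 'I_n.+2) (t : 'rV[R]_n.+1) :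
  coface i (coface j t) = coface (lift i j) (coface (face_swap i j) t).
Proof.
have swap k : lift i (lift j k) = lift (lift i j) (lift (face_swap i j) k).
  by apply: val_inj; rewrite /= face_swapE bumpC.
apply/rowP => k; case: (unliftP i k) => [l|] ->; last first.
  have := coface_lift (lift i j) (coface (face_swap i j) t) (face_swap i j).
  by rewrite lift_face_swap !coface_id.
rewrite coface_lift; case: (unliftP j l) => [m|] ->.
  by rewrite coface_lift swap !coface_lift.
by rewrite !coface_id.
Qed.

Lemma face_swap_sign n (i : 'I_n.+2) (j : 'I_n.+1) :
  (-1) ^+ (lift i j + face_swap i j) = - (-1) ^+ (i + j) :> rat.
Proof.
rewrite face_swapE /= -signr_odd -[in RHS]signr_odd /unbump /bump.
case: (leqP i j) => ij.
  by rewrite subn0 add1n addSn oddS addnC; case: odd.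
rewrite add0n subn1 -[in RHS](prednK (leq_ltn_trans (leq0n _) ij)) addSn oddS.
by rewrite addnC; case: odd.
Qed.

Lemma coface_continuous n i : continuous (@coface n i).
Proof.
move=> t A [P /= PA sPA]; exists (fun _ j => P 0 (lift i j)).
  by move=> k j; rewrite /= ord1 -(coface_lift i t); exact: PA.
move=> u Pu; apply: sPA => k j; rewrite ord1.
case: (unliftP i j) => [l|] ->; first by rewrite coface_lift; exact: (Pu 0).
by apply: nbhs_singleton; rewrite coface_id -(coface_id i t); exact: PA.
Qed.

Definition coface_simplex n (i : 'I_n.+2) (t : @std_simplex n) :
    @std_simplex n.+1 :=
  exist _ (coface i (val t)) (mem_set (std_simplex_coface i (set_mem (valP t)))).

Lemma coface_simplex_continuous n i : continuous (@coface_simplex n i).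
Proof.
apply: continuous_comp_initial => t.
apply: (@continuous_comp _ _ _ set_val (@coface n i)).
  exact: (@initial_continuous _ _ (set_val : @std_simplex n -> _)).
exact: coface_continuous.
Qed.

HB.instance Definition _ n i :=
  isContinuous.Build _ _ (@coface_simplex n i) (@coface_simplex_continuous n i).

Variable T : topologicalType.

Definition simplex n := continuousType (@std_simplex n) T.

Definition face n (s : simplex n.+1) (i : 'I_n.+2) : simplex n :=
  s \o @coface_simplex n i.

(* Rational chains of all dimensions together. *)
Definition sing_chain := {freeg {n : nat & simplex n} / rat}.

Definition simplex_boundary (s : {n : nat & simplex n}) : sing_chain :=
  match s with
  | existT 0 _ => 0
  | existT n.+1 s =>
      \sum_(i < n.+2)
         (-1) ^+ i *: << existT simplex n (face s i) >>%R
  end.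

Definition sing_boundary : sing_chain -> sing_chain := fglift simplex_boundary.

HB.instance Definition _ :=
  GRing.isZmodMorphism.Build _ _ sing_boundary (lift_is_additive simplex_boundary).

Lemma sing_boundaryU a s :
  sing_boundary << a *g s >> = a *: simplex_boundary s.
Proof. exact: liftU. Qed.

Lemma sing_boundaryZ a c : sing_boundary (a *: c) = a *: sing_boundary c.
Proof. exact: rat_linear (lift_is_additive _) a c. Qed.

Lemma face_face n (s : simplex n.+2) (i : 'I_n.+3) (j : 'I_n.+2) :
  face (face s i) j = face (face s (lift i j)) (face_swap i j).
Proof.
apply/continuousEP => t /=; congr (s _); apply: val_inj.
exact: coface_coface.
Qed.

Lemma sing_boundaryK c : sing_boundary (sing_boundary c) = 0.
Proof.
rewrite -[c]freeg_sumE !raddf_sum /= big1 // => -[n s] _.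
rewrite sing_boundaryU sing_boundaryZ.
suff -> : sing_boundary (simplex_boundary (existT simplex n s)) = 0.
  by rewrite scaler0.
case: n s => [|[|n]] s; first exact: raddf0.
  by rewrite raddf_sum /= big1 // => i _; rewrite sing_boundaryZ sing_boundaryU !scaler0.
pose F (p : 'I_n.+3 * 'I_n.+2) : sing_chain :=
  (-1) ^+ (p.1 + p.2) *: << existT simplex n (face (face s p.1) p.2) >>.
have -> : sing_boundary (simplex_boundary (existT simplex n.+2 s)) = \sum_p F p.
  rewrite raddf_sum -(pair_bigA _ (fun i j => F (i, j))) /=.
  apply: eq_bigr => i _; rewrite sing_boundaryZ sing_boundaryU scale1r.
  rewrite /= scaler_sumr; apply: eq_bigr => j _.
  by rewrite /F /= exprD scalerA.
pose swap (p : 'I_n.+3 * 'I_n.+2) := (lift p.1 p.2, face_swap p.1 p.2).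
have swapK : involutive swap.
  move=> [i j]; rewrite /swap /= lift_face_swap; congr (_, _).
  by rewrite {1}/face_swap lift_face_swap liftK.
have swapF p : F (swap p) = - F p.
  by rewrite /F /= face_swap_sign scaleNr -face_face.
have : \sum_p F p = - \sum_p F p.
  rewrite {1}(reindex_inj (inv_inj swapK)) -sumrN.
  by apply: eq_bigr => p _; exact: swapF.
move/eqP; rewrite -addr_eq0 -mulr2n -scaler_nat scaler_eq0 pnatr_eq0 /=.
by move/eqP.
Qed.

(* Singular i-chains of the subspace X of T: the simplices that occur have
   dimension i and image in X, so that only 0 is left if i < 0. *)
Definition sing_chains (i : int) (X : set T) : set sing_chain :=
  [set c | forall n (s : simplex n), coeff (existT simplex n s) c != 0 ->
     n%:Z = i /\ range s `<=` X].

Lemma sing_chains0 i X : sing_chains i X 0.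
Proof. by move=> n s; rewrite coeff0 eqxx. Qed.

Lemma sing_chainsB i X c d :
  sing_chains i X c -> sing_chains i X d -> sing_chains i X (c - d).
Proof.
move=> cX dX n s; rewrite coeffB.
have [c0|/cX //] := eqVneq (coeff (existT simplex n s) c) 0.
by rewrite c0 sub0r oppr_eq0 => /dX.
Qed.

Lemma sing_chainsD i X c d :
  sing_chains i X c -> sing_chains i X d -> sing_chains i X (c + d).
Proof.
move=> cX dX; rewrite -[d]opprK; apply: sing_chainsB => //.
by rewrite -[- d]sub0r; apply: sing_chainsB => //; exact: sing_chains0.
Qed.

Lemma sing_chainsZ i X a c : sing_chains i X c -> sing_chains i X (a *: c).
Proof.
by move=> cX n s; rewrite coeffZ mulf_eq0 negb_or => /andP[_ /cX].
Qed.

Lemma sing_chains_sub i X Y : X `<=` Y -> sing_chains i X `<=` sing_chains i Y.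
Proof. by move=> XY c cX n s /cX[-> sX]; split=> // y /sX /XY. Qed.

Lemma sing_chains_boundary i X c :
  sing_chains i X c -> sing_chains (i - 1) X (sing_boundary c).
Proof.
move=> cX; rewrite -[c]freeg_sumE raddf_sum /= big_seq.
apply: big_ind => [||[n s]]; [exact: sing_chains0|exact: sing_chainsD|].
rewrite mem_dom => /cX[<- sX]; rewrite sing_boundaryU; apply: sing_chainsZ.
case: n s sX => [|n] s sX; first exact: sing_chains0.
apply: big_ind => [||k _]; [exact: sing_chains0|exact: sing_chainsD|].
apply: sing_chainsZ => m u; rewrite coeffU mul1r pnatr_eq0 eqb0 negbK => /eqP su.
pose P (v : {n & simplex n}) :=
  (tag v)%:Z = n.+1%:Z - 1 /\ range (tagged v) `<=` X.
suff : P (existT simplex n (face s k)) by rewrite su.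
split; first by rewrite -addn1 PoszD addrK.
by move=> _ [t _ <-]; apply: sX; exists (coface_simplex k t).
Qed.

End SingularChains.

Section ToricDomains.
Variable R : realType.

Local Notation plane := 'rV[R]_2.

Definition quadrant : set plane := [set v | 0 <= v 0 0 /\ 0 <= v 0 1].

Definition quarter_circle : set plane :=
  [set v | quadrant v /\ v 0 0 ^+ 2 + v 0 1 ^+ 2 = 1].

(* C^oo functions on the quarter circle, a 1-manifold with boundary on which
   the angle is a global chart; smoothness up to the end points means that the
   function of the angle extends smoothly to the line. *)
Definition smooth_on_quarter_circle (r : plane -> R) :=
  exists2 F : R -> R,
    forall n x, derivable (derive1n n F) x 1 &
    forall theta, 0 <= theta <= pi / 2 ->
      r (\row_j (if j == 0 then cos theta else sin theta)) = F theta.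

Definition star_domain (Omega : set plane) :=
  exists r : plane -> R,
    [/\ smooth_on_quarter_circle r,
        forall z, quarter_circle z -> 0 < r z &
        Omega = [set v | exists t z,
          [/\ quarter_circle z, 0 <= t <= r z & v = t *: z]]].

Variable Omega : set plane.

Definition outer : set plane :=
  [set v : plane | 0 < v 0 0 /\ 0 < v 0 1] `\` Omega.

Definition outer_closure : set plane := closure outer `&` quadrant.

Definition concave_domain := convex_set (outer : set (convex_lmodType plane)).

Definition linform (m1 m2 : int) (y : plane) : R :=
  m1%:~R * y 0 0 + m2%:~R * y 0 1.

Definition outer_below (a : \bar R) (m : int * int) : set plane :=
  [set y | outer y /\ ((linform m.1 m.2 y)%:E < a)%E].

Definition toric_index : pred (int * int) :=
  fun m => ~~ ((m.1 <= 0) && (m.2 <= 0)).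

(* As H_*(S^1) has basis (e_0, e_1), an element of the tensor product is given
   by its components: x m j is the chain x_{m1,m2,j} at e_j, where e_0 is
   j = false and e_1 is j = true. *)
Definition toric_family := int * int -> bool -> sing_chain R plane.

(* The sign (-1)^|x| makes the operator depend on the degree n = |x|. *)
Definition toric_boundary (n : int) (x : toric_family) : toric_family :=
 fun m j =>
  if toric_index m then
    sing_boundary (x m j) +
    (if j then ((-1 : rat) ^ n) *: (m.2%:~R *: x (m.1 + 1, m.2) false
                                    - m.1%:~R *: x (m.1, m.2 + 1) false)
     else 0)
  else 0.

(* C^{Omega,a}_n inside the product of all copies of the singular chains of the
   plane: a direct sum, whence finiteness. The degree in the last clause solves
   2(m1+m2) - 1 + i + j = n for i; a = +oo gives C^Omega_n. *)
Definition toric_chains (a : \bar R) (n : int) : {pred toric_family} := fun x =>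
  `[< [/\ finite_set [set m | exists j, x m j != 0],
          forall m j, ~~ toric_index m -> x m j = 0 &
          forall m (j : bool), toric_index m ->
            sing_chains (n + 1 - 2 * (m.1 + m.2) - j%:Z) (outer_below a m)
              (x m j)] >].

Lemma toric_chains_zmod_closed a n : zmod_closed (toric_chains a n).
Proof.
split.
  apply/asboolP; split=> //; last by move=> m j _; exact: sing_chains0.
  by apply: (@sub_finite_set _ _ set0) => // m [j]; rewrite eqxx.
move=> x y /asboolP[xf x0 xa] /asboolP[yf y0 ya]; apply/asboolP; split.
- apply: (@sub_finite_set _ _ ([set m | exists j, x m j != 0] `|`
                               [set m | exists j, y m j != 0])).
    move=> m [j]; have [xj0 yj|xj _] := eqVneq (x m j) 0; last by left; exists j.
    right; exists j; apply: contra_neq yj => yj0.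
    by rewrite [LHS](_ : _ = x m j - y m j) // xj0 yj0 subr0.
  by rewrite finite_setU.
- by move=> m j mI; rewrite [LHS](_ : _ = x m j - y m j) // x0 // y0 // subr0.
- by move=> m j mI; apply: sing_chainsB; [exact: xa|exact: ya].
Qed.

HB.instance Definition _ a n :=
  GRing.isZmodClosed.Build toric_family (toric_chains a n)
    (toric_chains_zmod_closed a n).

Lemma toric_chains_le a b n : (a <= b)%E ->
  {homo idfun : x / x \in toric_chains a n >-> x \in toric_chains b n}.
Proof.
move=> ab x /asboolP[xf x0 xa]; apply/asboolP; split=> // m j mI.
by apply: sing_chains_sub (xa m j mI) => y [yU ya]; split=> //; exact: lt_le_trans ab.
Qed.

Lemma toric_boundary_is_zmod_morphism n : zmod_morphism (toric_boundary n).
Proof.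
move=> x y; apply/funext => m; apply/funext => j.
rewrite [RHS](_ : _ = toric_boundary n x m j - toric_boundary n y m j) //.
rewrite /toric_boundary; case: (toric_index m); last by rewrite subr0.
have E k i : (x - y) k i = x k i - y k i by [].
rewrite !E raddfB /=; case: j; last by rewrite !addr0.
rewrite opprD addrACA; congr (_ + _).
have BACA (A B C D : sing_chain R plane) : A - B - (C - D) = A - C - (B - D).
  by rewrite opprD addrACA -opprD.
by rewrite -scalerBr; congr (_ *: _); rewrite BACA -!scalerBr.
Qed.

HB.instance Definition _ n :=
  GRing.isZmodMorphism.Build _ _ (toric_boundary n)
    (toric_boundary_is_zmod_morphism n).

Lemma toric_indexS m : toric_index m ->
  toric_index (m.1 + 1, m.2) /\ toric_index (m.1, m.2 + 1).
Proof. rewrite /toric_index /=; lia. Qed.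

Lemma toric_boundary_chains a n :
  {homo toric_boundary n :
    x / x \in toric_chains a n >-> x \in toric_chains a (n - 1)}.
Proof.
move=> x /asboolP[xf x0 xa]; apply/asboolP; split.
- pose S := [set m | exists j, x m j != 0].
  apply: (@sub_finite_set _ _ (S `|`
      ((fun m => (m.1 - 1, m.2)) @` S `|` (fun m => (m.1, m.2 - 1)) @` S))).
    move=> m [j]; rewrite /toric_boundary.
    have [Sm|Sm] := pselect (S m); first by left.
    have [S1|S1] := pselect (S (m.1 + 1, m.2)).
      by right; left; exists (m.1 + 1, m.2) => //=; rewrite addrK -surjective_pairing.
    have [S2|S2] := pselect (S (m.1, m.2 + 1)).
      by right; right; exists (m.1, m.2 + 1) => //=; rewrite addrK -surjective_pairing.
    have xS p i : ~ S p -> x p i = 0.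
      by move=> Sp; apply/eqP/negP => /negP xp; apply: Sp; exists i.
    by rewrite !xS // raddf0 !scaler0 subrr scaler0 !if_same addr0 if_same eqxx.
  by rewrite !finite_setU; split=> //; split; exact: finite_image.
- by move=> m j mI; rewrite /toric_boundary (negbTE mI).
- move=> m j mI; rewrite /toric_boundary mI.
  have [mI1 mI2] := toric_indexS mI.
  have deg (i k : int) X c : i = k -> sing_chains i X c -> sing_chains k X c.
    by move=> ->.
  apply: sing_chainsD.
    by apply: deg (sing_chains_boundary (xa m j mI)); lia.
  case: j; last exact: sing_chains0.
  apply: sing_chainsZ; apply: sing_chainsB; apply: sing_chainsZ.
    apply: deg (sing_chains_sub _ (xa _ false mI1)) => /=; first by lia.
    move=> y [yU ya]; split=> //; apply: le_lt_trans ya; rewrite lee_fin.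
    case: yU => -[y0 y1] _; rewrite /linform /= rmorphD /= mulrDl mul1r; lra.
  apply: deg (sing_chains_sub _ (xa _ false mI2)) => /=; first by lia.
  move=> y [yU ya]; split=> //; apply: le_lt_trans ya; rewrite lee_fin.
  case: yU => -[y0 y1] _; rewrite /linform /= rmorphD /= mulrDl mul1r; lra.
Qed.

Lemma toric_boundaryK (n : int) x :
  toric_boundary (n - 1) (toric_boundary n x) = 0.
Proof.
apply/funext => m; apply/funext => j; rewrite /toric_boundary.
rewrite [RHS](_ : _ = 0) //; case: ifP => // mI; rewrite ?mI.
have [-> ->] := toric_indexS mI.
case: j => /=; last by rewrite !addr0 sing_boundaryK.
rewrite !addr0 raddfD /= sing_boundaryK add0r !sing_boundaryZ raddfB /=.
rewrite !sing_boundaryZ -scalerDl [X in X *: _](_ : _ = 0) ?scale0r //.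
by rewrite expfzDr // exprN1 invrN1 mulrN1 subrr.
Qed.

Definition toric_diff_family (i j : int) (x : toric_family) : toric_family :=
  if i == j + 1 then toric_boundary i x else 0.

Lemma toric_diff_family_is_zmod_morphism i j :
  zmod_morphism (toric_diff_family i j).
Proof.
move=> x y; rewrite /toric_diff_family.
by case: ifP => _; rewrite ?raddfB ?subrr.
Qed.

HB.instance Definition _ i j :=
  GRing.isZmodMorphism.Build _ _ (toric_diff_family i j)
    (toric_diff_family_is_zmod_morphism i j).

Lemma toric_diff_chains a i j :
  {homo toric_diff_family i j :
    x / x \in toric_chains a i >-> x \in toric_chains a j}.
Proof.
move=> x xa; rewrite /toric_diff_family; case: eqP => [ij|_]; last exact: rpred0.
by have := toric_boundary_chains xa; rewrite {2}ij addrK.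
Qed.

Section ChainComplex.
Variable a : \bar R.

Let obj n : zmodType := subgroup (toric_chains a n).
Let diff i j : {additive obj i -> obj j} :=
  subgroup_map (@toric_diff_chains a i j).

Lemma toric_diff_shape i j x : i != j + 1 -> diff i j x = 0.
Proof.
by move=> ij; apply: val_inj; rewrite /= /toric_diff_family (negbTE ij).
Qed.

Lemma toric_diff_diff i j k x : diff j k (diff i j x) = 0.
Proof.
apply: val_inj; rewrite /= /toric_diff_family.
case: eqP => [jk|_] //; case: eqP => [ij|_]; last by rewrite raddf0.
by rewrite -[X in toric_boundary X](addrK 1 j) -ij toric_boundaryK.
Qed.

Definition toric_complex := ChainComplex toric_diff_shape toric_diff_diff.

End ChainComplex.

Section Inclusion.
Variables (a b : \bar R) (ab : (a <= b)%E).

Let incl n : {additive toric_complex a n -> toric_complex b n} :=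
  subgroup_map (toric_chains_le ab).

Lemma inclE i j x :
  cdiff (toric_complex b) i j (incl i x) = incl j (cdiff (toric_complex a) i j x).
Proof. exact: val_inj. Qed.

Definition toric_incl := ChainMap inclE.

End Inclusion.

(* C^{Omega,a} as a subcomplex of C^{Omega,b} when a <= b, and in general the
   intersection of the two. *)
Definition toric_level (a b : \bar R) (n : int) : {pred toric_complex b n} :=
  fun x => val x \in toric_chains a n.

Lemma toric_level_zmod_closed a b n : zmod_closed (@toric_level a b n).
Proof.
split; first exact: rpred0.
move=> x y xa ya; rewrite unfold_in /toric_level raddfB.
exact: (rpredB (xa : val x \in toric_chains a n) ya).
Qed.

HB.instance Definition _ a b n :=
  GRing.isZmodClosed.Build (toric_complex b n) (@toric_level a b n)
    (toric_level_zmod_closed a b n).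

Lemma toric_level_diff a b i j : {homo cdiff (toric_complex b) i j :
  x / x \in @toric_level a b i >-> x \in @toric_level a b j}.
Proof. by move=> x xa; exact: toric_diff_chains. Qed.

(* C^{Omega,[a,b)}; when b <= a this is the zero complex. *)
Definition toric_window (a b : \bar R) : chain_complex :=
  quotient_complex (@toric_level_diff a b).

Lemma toric_level_incl a b a' b' (aa' : (a <= a')%E) (bb' : (b <= b')%E) n :
  {homo toric_incl bb' n :
    x / x \in @toric_level a b n >-> x \in @toric_level a' b' n}.
Proof. by move=> x xa; exact: (toric_chains_le aa'). Qed.

Definition window_map a b a' b' (aa' : (a <= a')%E) (bb' : (b <= b')%E) :
    chain_map (toric_window a b) (toric_window a' b') :=
  quotient_complex_map (@toric_level_diff a b) (@toric_level_diff a' b')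
    (toric_level_incl aa' bb').

(* The inverse limit for delta -> 0+ is taken over all delta > 0: the groups
   with delta >= a vanish, so they do not change it. *)
Definition positive_family (n : int) (a : \bar R) :=
  forall delta : {posnum R}, homology (toric_window delta%:num%:E a) n.

Definition positive_homology (n : int) (a : \bar R) : set (positive_family n a) :=
  [set h | forall (d d' : {posnum R}) (dd' : (d%:num%:E <= d'%:num%:E)%E),
     homology_map (window_map dd' (lexx a)) n (h d) = h d'].

Definition positive_homology_map (n : int) (a : \bar R)
    (h : positive_family n a) : positive_family n +oo%E :=
  fun d => homology_map (window_map (lexx d%:num%:E) (leey a)) n (h d).

Definition positive_homology_map_neq0 (n : int) (a : \bar R) :=
  exists2 h, @positive_homology n a h & positive_homology_map h <> (fun=> 0).

Definition capacity (k : nat) : \bar R :=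
  ereal_inf [set a%:E | a in [set a : R |
    0 < a /\ positive_homology_map_neq0 (2 * k%:Z + 1) a%:E]].

End ToricDomains.

Definition is_min (R : realType) (A : set R) (x : R) := A x /\ lbound A x.

(* Main.v *)
(* Capping with cone operators shows that the homology of a window [delta, a) of
   the complex only sees, in odd degree 2k + 1, the augmentations of the e_0
   components at those (m1, m2) for which the part of U_Omega below level delta
   is empty. For small delta these are the m with m1, m2 >= 1: if some m_i <= 0,
   points of U_Omega near a coordinate axis have arbitrarily small A_m. The
   augmentations z_j at (j, k + 1 - j) are then subject to
   (k - j) z_{j+1} = j z_j, whose solutions are the multiples of
   (j - 1)! (k - j)!, all nonzero; hence a nonzero class exists at level a if and
   only if every U_Omega(a : j, k + 1 - j) is nonempty, i.e. if a exceeds each of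
   the minima, and it survives at level infinity. *)
Require Import Defs.
From HB Require Import structures.
From mathcomp.multinomials Require Import freeg.
From mathcomp Require Import all_boot all_order all_algebra.
From mathcomp Require Import all_classical all_reals all_analysis.
From mathcomp Require Import ring_quotient zify ring lra.

Set Implicit Arguments.
Unset Strict Implicit.
Unset Printing Implicit Defensive.

Import Order.TTheory GRing.Theory Num.Theory.
Import numFieldNormedType.Exports.

Local Open Scope classical_set_scope.
Local Open Scope ring_scope.

(** * Topology of the standard simplex *)

Section StdSimplex.
Variable R : realType.

Lemma std_simplex_le1 n (t : 'rV[R]_n.+1) i : std_simplex t -> t 0 i <= 1.
Proof.
move=> [t0 <-]; rewrite (bigD1 i) //= lerDl.
by apply: sumr_ge0 => j _; exact: t0.
Qed.

Lemma std_simplex_vertex n : @std_simplex R n (delta_mx 0 0).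
Proof.
split=> [i|]; first by rewrite mxE ler0n.
rewrite (bigD1 0) //= big1 ?addr0 ?mxE ?eqxx // => i /negbTE i0.
by rewrite mxE i0 andbF.
Qed.

(** It is closed in the unit cube. Compactness is what bounds a singular simplex, and so controls
    its cone near the apex. *)
Lemma std_simplex_compact n : compact (@std_simplex R n).
Proof.
apply: (@subclosed_compact _ _
  [set v : 'rV[R]_n.+1 | forall i, v ord0 i \in `[0, 1]]).
- have -> : @std_simplex R n =
      (\bigcap_i [set t : 'rV[R]_n.+1 | t 0 i \in `[0, +oo[ ]) `&`
      [set t | \sum_i t 0 i = 1].
    apply/seteqP; split=> t [t0 t1]; split=> // i.
      by move=> _; rewrite /= in_itv /= andbT; exact: t0.
    by have := t0 i I; rewrite /= in_itv /= andbT.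
  apply: closedI.
    apply: closed_bigI => i _.
    apply: (@preimage_closed _ _ (fun t : 'rV[R]_n.+1 => t 0 i) [set` `[0, +oo[]).
      by move=> x _; exact: coord_continuous.
    exact: interval_closed.
  apply: (@preimage_closed _ _ (fun t : 'rV[R]_n.+1 => \sum_i t 0 i) [set 1]).
    move=> x _; apply: continuous_big => [|i _]; last exact: coord_continuous.
    exact: add_continuous.
  exact: closed_eq.
- apply: (@rV_compact _ _ (fun=> `[0 : R, 1]%classic)) => _; exact: segment_compact.
- move=> t tS i; rewrite in_itv /= std_simplex_le1 // andbT.
  by case: tS => + _; apply.
Qed.

Lemma std_simplex_coface_iff n (i : 'I_n.+2) (t : 'rV[R]_n.+1) :
  std_simplex (coface i t) <-> std_simplex t.
Proof.
split; last exact: std_simplex_coface.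
move=> [t0 t1]; split=> [j|]; first by rewrite -(coface_lift i).
rewrite -t1 [RHS](bigD1_ord i) //= coface_id add0r.
by apply: eq_bigr => j _; rewrite coface_lift.
Qed.

Lemma std_simplex0 (t : 'rV[R]_1) : std_simplex t -> t 0 0 = 1.
Proof. by case=> _; rewrite big_ord1. Qed.

End StdSimplex.

(** * The cone over a singular simplex with apex [p] *)

Section ConeSimplex.
Variables (R : realType) (V : normedModType R) (p : V) (n : nat).
Variable s : simplex R V n.

(** Extending by 0 off the simplex lets the cone be given by a formula on all row vectors, without
    membership proofs in it. *)
Definition simplex_ext (u : 'rV[R]_n.+1) : V :=
  if pselect (std_simplex u) is left uS then s (exist _ u (mem_set uS)) else 0.

Lemma simplex_extE (u : @std_simplex R n) : simplex_ext (val u) = s u.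
Proof.
case: u => u uS; rewrite /simplex_ext.
case: pselect => [uS'|]; last by move/(_ (set_mem uS)).
by congr (s _); apply: val_inj.
Qed.

Lemma simplex_ext_continuous : {within @std_simplex R n, continuous simplex_ext}.
Proof.
apply/subspace_sigL_continuousP.
suff -> : sigL (@std_simplex R n) simplex_ext = s by exact: cts_fun.
by apply/funext => u; exact: simplex_extE.
Qed.

(* The point of the opposite face on the line from the 0-th vertex through t. *)
Definition cone_base (t : 'rV[R]_n.+2) : 'rV[R]_n.+1 :=
  (1 - t 0 0)^-1 *: \row_j t 0 (lift 0 j).

(** At the apex [t 0 0 = 1] the inverse in [cone_base] takes its default value 0, but its weight
    [1 - t 0 0] vanishes too, so the value is [p]. *)
Definition cone_fun (t : 'rV[R]_n.+2) : V :=
  t 0 0 *: p + (1 - t 0 0) *: simplex_ext (cone_base t).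

Lemma std_simplex_cone_base t :
  std_simplex t -> t 0 0 != 1 -> std_simplex (cone_base t).
Proof.
move=> tS t1; have t0 : 0 < 1 - t 0 0.
  by rewrite subr_gt0 lt_neqAle t1 std_simplex_le1.
case: tS => tge0 tsum; split=> [i|].
  by rewrite !mxE mulr_ge0 // invr_ge0 ltW.
under eq_bigr do rewrite !mxE.
rewrite -mulr_sumr (_ : \sum_(i < n.+1) _ = 1 - t 0 0) ?mulVf ?gt_eqF //.
by rewrite -tsum [in RHS](bigD1_ord 0) //= addrAC subrr add0r.
Qed.

Lemma cone_tail_continuous :
  continuous (fun t : 'rV[R]_n.+2 => \row_j t 0 (lift 0 j) : 'rV[R]_n.+1).
Proof.
move=> t A [P /= PA sPA].
(* A box that leaves the 0-th coordinate unconstrained. *)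
exists (fun _ j => if unlift 0 j is Some k then P 0 k else setT).
  move=> k j; rewrite /= ord1; case: unliftP => [l jE|_]; last exact: filterT.
  by have := PA 0 l; rewrite mxE jE.
move=> u Pu; apply: sPA => k j; rewrite ord1 mxE.
by have := Pu 0 (lift 0 j); rewrite liftK.
Qed.

(** Away from the apex this is a composition of continuous maps. At the apex [cone_base] has no
    limit, but [simplex_ext] is bounded on the compact simplex and its factor [1 - t 0 0] tends to
    0. *)
Lemma cone_fun_cvg (t : 'rV[R]_n.+2) : std_simplex t ->
  cone_fun x @[x --> within (@std_simplex R n.+1) (nbhs t)] --> cone_fun t.
Proof.
move=> tS; set F := within _ _.
have tF : (x : 'rV[R]_n.+2) 0 0 @[x --> F] --> t 0 0.
  apply: (@cvg_within_filter _ _ _ (nbhs t) _ (nbhs (t 0 0)) (@std_simplex R n.+1)).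
  exact: coord_continuous.
have t1F : 1 - (x : 'rV[R]_n.+2) 0 0 @[x --> F] --> 1 - t 0 0.
  by apply: cvgB => //; exact: cvg_cst.
have [t1|t1] := eqVneq (t 0 0) 1.
  have [M [_ Mext]] : bounded_set (simplex_ext @` @std_simplex R n).
    apply: compact_bounded; apply: continuous_compact.
      exact: simplex_ext_continuous.
    exact: std_simplex_compact.
  pose B := `|M| + 1.
  have extB u : std_simplex u -> `|simplex_ext u| <= B.
    move=> uS; apply: (Mext B); last by exists u.
    by rewrite (le_lt_trans (ler_norm M)) // ltrDl.
  rewrite [X in _ --> X](_ : _ = t 0 0 *: p + 0); last first.
    by rewrite /cone_fun t1 subrr scale0r.
  apply: cvgD; first exact: cvgZr_tmp.
  apply: norm_cvg0.
  apply: (@squeeze_cvgr _ _ _ _ (fun=> 0)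
            (fun x : 'rV[R]_n.+2 => `|1 - x 0 0| * B)).
  - near=> x; rewrite normr_ge0 /= normrZ.
    have [->|x1] := eqVneq (x 0 0) 1; first by rewrite subrr normr0 !mul0r.
    apply: ler_wpM2l => //; apply: extB; apply: std_simplex_cone_base => //.
    by near: x; exact: withinT.
  - exact: cvg_cst.
  - rewrite [X in _ --> X](_ : _ = `|1 - t 0 0| * B); last first.
      by rewrite t1 subrr normr0 mul0r.
    by apply: cvgMr_tmp; exact: cvg_norm.
apply: cvgD; first exact: cvgZr_tmp.
apply: cvgZ => //.
have /subspace_continuousP extc := simplex_ext_continuous.
have := extc _ (std_simplex_cone_base tS t1).
apply: cvg_comp => A /= At.
have cb : cone_base x @[x --> F] --> cone_base t.
  apply: cvgZ; first by apply: cvgV => //; rewrite subr_eq0 eq_sym.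
  apply: (@cvg_within_filter _ _ _ (nbhs t) _ _ (@std_simplex R n.+1)).
  exact: cone_tail_continuous.
have AF : \forall x \near F, std_simplex (cone_base x) -> A (cone_base x).
  exact: cb At.
(* This keeps [cone_base x] inside the simplex, where [simplex_ext] is known to be continuous. *)
have neF : \forall x \near F, 1 - (x : 'rV[R]_n.+2) 0 0 != 0.
  by apply: (cvgr_neq0 _ t1F); rewrite subr_eq0 eq_sym.
near=> x; apply: (near AF x) => //; apply: std_simplex_cone_base.
  by near: x; exact: withinT.
by rewrite eq_sym -subr_eq0; near: x.
Unshelve. all: by end_near. Qed.

Definition cone_simplex (t : @std_simplex R n.+1) : V := cone_fun (val t).

Lemma cone_simplex_continuous : continuous cone_simplex.
Proof.
apply/subspace_sigL_continuousP/subspace_continuousP => t.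
exact: cone_fun_cvg.
Qed.

HB.instance Definition _ :=
  isContinuous.Build _ _ cone_simplex cone_simplex_continuous.

Definition cone : simplex R V n.+1 := cone_simplex.

Lemma cone_range (X : set V) :
    (forall y (l : R), X y -> 0 <= l <= 1 -> X (l *: p + (1 - l) *: y)) ->
  range s `<=` X -> range cone `<=` X.
Proof.
move=> pX sX _ [t _ <-]; rewrite /cone /= /cone_simplex /cone_fun.
have /set_mem tS := valP t.
have t01 : 0 <= val t 0 0 <= 1.
  by rewrite std_simplex_le1 // andbT; case: tS => + _; apply.
have [t1|t1] := eqVneq (val t 0 0) 1.
  (* At the apex one needs [X p]; it follows from star-shapedness with [l = 1], applied to any point
     of the image of [s], here that of a vertex. *)
  rewrite t1 subrr scale0r addr0 scale1r.
  pose v : @std_simplex R n :=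
    exist _ (delta_mx 0 0) (mem_set (std_simplex_vertex R n)).
  have := pX (s v) 1 (sX _ (ex_intro2 _ _ v I erefl)).
  by rewrite subrr scale0r addr0 scale1r; apply; rewrite ler01 lexx.
apply: pX => //.
pose u : @std_simplex R n :=
  exist _ (cone_base (val t)) (mem_set (std_simplex_cone_base tS t1)).
rewrite -[cone_base _]/(val u) simplex_extE.
by apply: sX; exists u.
Qed.

End ConeSimplex.

(** * Faces of a cone *)

Section ConeFaces.
Variables (R : realType) (V : normedModType R) (p : V).

Definition point_simplex : simplex R V 0 := cst p.

Lemma cone_fun_coface0 n (s : simplex R V n) (t : @std_simplex R n) :
  cone_fun p s (coface 0 (val t)) = s t.
Proof.
rewrite /cone_fun /cone_base coface_id scale0r add0r subr0 invr1 !scale1r.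
rewrite -simplex_extE; congr (simplex_ext s _).
by apply/rowP => j; rewrite mxE coface_lift.
Qed.

Lemma face_cone0 n (s : simplex R V n) : face (cone p s) 0 = s.
Proof. by apply/continuousEP => t; exact: cone_fun_coface0. Qed.

Lemma face_cone_point (s : simplex R V 0) i :
  face (cone p s) (lift 0 i) = point_simplex.
Proof.
apply/continuousEP => t /=; rewrite /cone_simplex /cone_fun /=.
have -> : coface (lift 0 i) (val t) 0 0 = 1.
  rewrite (_ : 0 = lift (lift 0 i) 0); last first.
    by apply: val_inj; rewrite (ord1 i).
  by rewrite coface_lift std_simplex0 //; exact: set_mem (valP t).
by rewrite scale1r subrr scale0r addr0.
Qed.

(** A coface lies in the simplex exactly when [u] does, so the default value 0 is taken on both
    sides simultaneously. *)
Lemma simplex_ext_coface n (s : simplex R V n.+1) i u :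
  simplex_ext s (coface i u) = simplex_ext (face s i) u.
Proof.
rewrite /simplex_ext; case: pselect => iu; case: pselect => uS //.
- by congr (s _); apply: val_inj.
- by case: uS; apply/(std_simplex_coface_iff i).
- by case: iu; apply/(std_simplex_coface_iff i).
Qed.

Lemma face_cone_lift n (s : simplex R V n.+1) i :
  face (cone p s) (lift 0 i) = cone p (face s i).
Proof.
apply/continuousEP => t /=; rewrite /cone_simplex /cone_fun /=.
have E (u : 'rV[R]_n.+2) : coface (lift 0 i) u 0 0 = u 0 0.
  rewrite [X in coface _ _ _ X](_ : _ = lift (lift 0 i) 0) ?coface_lift //.
  exact: val_inj.
rewrite E -simplex_ext_coface; congr (_ + _ *: simplex_ext s _).
rewrite /cone_base E; apply/rowP => j.
rewrite [LHS]mxE [X in _ * X]mxE; case: (unliftP i j) => [k|] ->.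
  rewrite coface_lift [RHS]mxE [X in _ = _ * X]mxE; congr (_ * _).
  have -> : lift 0 (lift i k) = lift (lift 0 i) (lift 0 k).
    by apply: val_inj; rewrite /= /bump /= !add1n ltnS addnS.
  exact: coface_lift.
by rewrite !coface_id mulr0.
Qed.

End ConeFaces.

(** * The cone operator on chains and the augmentation *)

Section ConeOperator.
Variables (R : realType) (V : normedModType R).

Local Notation chain := (sing_chain R V).
Local Notation simplices := {n : nat & simplex R V n}.

Definition cone_generator (p : V) (s : simplices) : chain :=
  << existT (simplex R V) (tag s).+1 (cone p (tagged s)) >>%R.

Definition cone_chain (p : V) : chain -> chain := fglift (cone_generator p).

HB.instance Definition _ p := GRing.isZmodMorphism.Build _ _ (cone_chain p)
  (lift_is_additive (cone_generator p)).

Lemma cone_chainZ p a c : cone_chain p (a *: c) = a *: cone_chain p c.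
Proof. exact: rat_linear (lift_is_additive _) a c. Qed.

(** Since chains of all dimensions live together, simplices of positive dimension are sent to 0. *)
Definition augmentation : chain -> rat :=
  fglift (fun s : simplices => (tag s == 0%N)%:R : rat^o).

HB.instance Definition _ := GRing.isZmodMorphism.Build _ _ augmentation
  (lift_is_additive (fun s : simplices => (tag s == 0%N)%:R : rat^o)).

Lemma augmentationU a s : augmentation << a *g s >> = a * (tag s == 0%N)%:R.
Proof. by rewrite [LHS]liftU. Qed.

Lemma augmentationZ a c : augmentation (a *: c) = a * augmentation c.
Proof. exact: (@rat_linear _ rat^o _ (lift_is_additive _) a c). Qed.

Definition point_chain (p : V) : chain :=
  << existT (simplex R V) 0%N (point_simplex p) >>%R.

Lemma sing_chain_ind (P : chain -> Prop) :
  P 0 -> (forall c d, P c -> P d -> P (c + d)) ->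
  (forall a c, P c -> P (a *: c)) -> (forall s, P << s >>%R) ->
  forall c, P c.
Proof.
move=> P0 PD PZ PU c; rewrite -[c]freeg_sumE.
apply: big_ind => // s _; rewrite -[coeff s c]mulr1.
have -> : << coeff s c * 1 *g s >> = coeff s c *: << s >> :> chain.
  by apply/eqP/freeg_eqP => z; rewrite coeffZ !coeffU mulrA.
by apply: PZ; exact: PU.
Qed.

(** Only 1-simplices have 0-dimensional faces, and their two faces carry opposite signs. *)
Lemma augmentation_boundary c : augmentation (sing_boundary c) = 0.
Proof.
elim/sing_chain_ind: c => [|c d cE dE|a c cE|[n s]].
- by rewrite !raddf0.
- by rewrite !raddfD /= cE dE addr0.
- by rewrite sing_boundaryZ augmentationZ cE mulr0.
rewrite sing_boundaryU scale1r; case: n s => [|n] s; first exact: raddf0.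
rewrite raddf_sum /=; under eq_bigr do rewrite augmentationZ augmentationU mul1r.
case: n s => [|n] s; last by rewrite big1 // => i _; rewrite mulr0.
by rewrite !big_ord_recl big_ord0 /= expr0 !mul1r addr0 mulr1 subrr.
Qed.

(** Face 0 of a cone is the simplex itself; the other faces are cones over its faces, with the sign
    shifted by one. Over a 0-simplex the other face is the apex, which produces the augmentation
    term. *)
Lemma sing_boundary_cone p c : sing_boundary (cone_chain p c) =
  c - cone_chain p (sing_boundary c) - augmentation c *: point_chain p.
Proof.
elim/sing_chain_ind: c => [|c d cE dE|a c cE|[n s]].
- by rewrite !raddf0 scale0r !(subr0, addr0).
- rewrite [cone_chain p (c + d)]raddfD [augmentation _]raddfD.
  rewrite [sing_boundary (c + d)]raddfD /= [cone_chain p (_ + _)]raddfD.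
  rewrite [LHS]raddfD /= cE dE scalerDl [LHS]addrACA -opprD; congr (_ - _).
  by rewrite addrACA -opprD.
- rewrite cone_chainZ !sing_boundaryZ cE cone_chainZ augmentationZ -scalerA.
  by rewrite !scalerBr.
rewrite [cone_chain p _]liftU sing_boundaryU augmentationU !scale1r.
rewrite sing_boundaryU scale1r mul1r /=.
rewrite big_ord_recl expr0 scale1r face_cone0 -addrA; congr (_ + _).
case: n s => [|n] s.
  rewrite big_ord1 face_cone_point raddf0 oppr0 add0r scale1r.
  by rewrite scaleN1r.
rewrite scale0r subr0 /= raddf_sum -sumrN; apply: eq_bigr => i _.
rewrite face_cone_lift exprS mulN1r scaleNr /= cone_chainZ.
by congr (- (_ *: _)); rewrite [RHS]liftU scale1r.
Qed.

Lemma cone_chains i (X : set V) p c :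
    (forall y (l : R), X y -> 0 <= l <= 1 -> X (l *: p + (1 - l) *: y)) ->
  sing_chains i X c -> sing_chains (i + 1) X (cone_chain p c).
Proof.
move=> pX cX; rewrite -[c]freeg_sumE raddf_sum /= big_seq.
apply: big_ind => [||[n s]]; [exact: sing_chains0|exact: sing_chainsD|].
rewrite mem_dom => /cX[<- sX]; rewrite [cone_chain p _]liftU.
apply: sing_chainsZ => m u; rewrite coeffU mul1r pnatr_eq0 eqb0 negbK => /eqP su.
pose P (v : simplices) := (tag v)%:Z = n%:Z + 1 /\ range (tagged v) `<=` X.
suff : P (existT (simplex R V) n.+1 (cone p s)) by rewrite su.
by split; [rewrite /= -addn1 PoszD|exact: cone_range].
Qed.

Lemma augmentation_dim i X c : i != 0 -> sing_chains i X c -> augmentation c = 0.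
Proof.
move=> i0 cX; rewrite -[c]freeg_sumE raddf_sum /= big_seq big1 // => -[n s].
rewrite mem_dom => /cX[iE _]; rewrite augmentationU /= -eqz_nat iE.
by rewrite (negbTE i0) mulr0.
Qed.

Lemma sing_chains_set0 i X c : X = set0 -> sing_chains i X c -> c = 0 :> chain.
Proof.
move=> -> cX; apply/eqP/freeg_eqP => -[n s]; rewrite coeff0; apply/eqP.
apply: contraT => /cX[_ s0]; exfalso.
pose v : @std_simplex R n :=
  exist _ (delta_mx 0 0) (mem_set (std_simplex_vertex R n)).
by apply: (s0 (s v)); exists v.
Qed.

Lemma point_chains X p : X p -> sing_chains 0 X (point_chain p).
Proof.
move=> Xp m u; rewrite coeffU mul1r pnatr_eq0 eqb0 negbK => /eqP su.
pose P (v : simplices) := (tag v)%:Z = 0 /\ range (tagged v) `<=` X.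
suff : P (existT (simplex R V) 0%N (point_simplex p)) by rewrite su.
by split=> //= _ [t _ <-].
Qed.

Lemma augmentation_point p : augmentation (point_chain p) = 1.
Proof. by rewrite augmentationU mul1r. Qed.

End ConeOperator.

(** * Cone homotopies in the toric complex *)

Section ToricChains.
Variables (R : realType) (Omega : set 'rV[R]_2).

Local Notation plane := 'rV[R]_2.
Local Notation below := (outer_below Omega).
Local Notation chains := (toric_chains Omega).

Lemma toric_chains_sing a n x : x \in chains a n ->
  forall (m : int * int) (j : bool),
  sing_chains (n + 1 - 2 * (m.1 + m.2) - j%:Z) (below a m) (x m j).
Proof.
move=> /asboolP[_ x0 xa] m j; have [mI|mI] := boolP (toric_index m).
  exact: xa.
by rewrite x0 //; exact: sing_chains0.
Qed.

#[global] Arguments toric_chains_sing [a n x] _ m j.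

Lemma toric_chains_index a n x m j : x \in chains a n -> ~~ toric_index m ->
  x m j = 0.
Proof. by move=> /asboolP[_ x0 _]; exact: x0. Qed.

Lemma toric_chains_finite a n x : x \in chains a n ->
  finite_set [set m | exists j, x m j != 0].
Proof. by move=> /asboolP[]. Qed.

Definition toric_row (j0 : bool) (f : int * int -> sing_chain R plane) :
  toric_family R := fun m j => if j == j0 then f m else 0.

Lemma toric_row_chains a n (j0 : bool) (f : int * int -> sing_chain R plane) :
    finite_set [set m | f m != 0] ->
    (forall m, ~~ toric_index m -> f m = 0) ->
    (forall m, toric_index m ->
       sing_chains (n + 1 - 2 * (m.1 + m.2) - j0%:Z) (below a m) (f m)) ->
  toric_row j0 f \in chains a n.
Proof.
move=> ffin f0 fa; apply/asboolP; split.
- apply: sub_finite_set ffin => m [j]; rewrite /toric_row /=.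
  by case: (j == j0) => //; rewrite eqxx.
- by move=> m j mI; rewrite /toric_row f0 // if_same.
- move=> m j mI; rewrite /toric_row; case: eqP => [->|_]; first exact: fa.
  exact: sing_chains0.
Qed.

Lemma outer_below_le a b m : (a <= b)%E -> below a m `<=` below b m.
Proof. by move=> ab y [yU ya]; split=> //; exact: lt_le_trans ab. Qed.

(** One apex serves both levels: it lies below [Order.min d b] whenever possible, so that for
    [d <= b] coning preserves the level [d] as well as the level [b]. Otherwise any point below [b]
    is taken, and 0 if there is none. *)
Definition base_point (d b : \bar R) (m : int * int) : plane :=
  xget (xget 0 (below b m)) (below (Order.min d b) m).

Lemma base_point_low d b m : below (Order.min d b) m !=set0 ->
  below (Order.min d b) m (base_point d b m).
Proof. by move=> ne; rewrite /base_point; exact: xgetPex. Qed.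

Lemma base_point_high d b m : below b m !=set0 -> below b m (base_point d b m).
Proof.
move=> ne; have [ned|/forallNP ed] := pselect (below (Order.min d b) m !=set0).
  by apply: outer_below_le (base_point_low ned); rewrite ge_min lexx orbT.
by rewrite /base_point xgetPN //; exact: xgetPex.
Qed.

Hypothesis Omega_concave : concave_domain Omega.

(** Sublevel sets of a linear form in the convex set [outer Omega] are convex. For finite [b]
    strictness is drawn from [p], except for [l = 0], where the point is [y]. *)
Lemma outer_below_segment b m (p y : plane) (l : R) :
  below b m p -> below b m y -> 0 <= l <= 1 -> below b m (l *: p + (1 - l) *: y).
Proof.
move=> [pU pb] [yU yb] /andP[l0 l1]; split.
  have := Omega_concave (Itv01 l0 l1) (mem_set pU) (mem_set yU).
  by move/set_mem.
have -> : linform m.1 m.2 (l *: p + (1 - l) *: y) =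
    l * linform m.1 m.2 p + (1 - l) * linform m.1 m.2 y.
  by rewrite /linform !mxE; ring.
case: b pb yb => [b| |]; [|by move=> *; exact: ltry|by rewrite ltNge leNye].
rewrite !lte_fin => pb yb.
have [->|l0'] := eqVneq l 0; first by rewrite mul0r add0r subr0 mul1r.
have lp : l * linform m.1 m.2 p < l * b.
  by rewrite ltr_pM2l // lt_neqAle eq_sym l0'.
have ly : (1 - l) * linform m.1 m.2 y <= (1 - l) * b.
  by rewrite ler_wpM2l ?subr_ge0 // ltW.
lra.
Qed.

Lemma base_cone_high d b m (y : plane) (l : R) : below b m y -> 0 <= l <= 1 ->
  below b m (l *: base_point d b m + (1 - l) *: y).
Proof.
by move=> yb; apply: outer_below_segment => //; apply: base_point_high; exists y.
Qed.

Lemma base_cone_low d b m (y : plane) (l : R) : (d <= b)%E ->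
  below d m y -> 0 <= l <= 1 ->
  below d m (l *: base_point d b m + (1 - l) *: y).
Proof.
move=> db yd; have /base_point_low : below (Order.min d b) m !=set0.
  by exists y; rewrite min_l.
by rewrite min_l // => pd; exact: outer_below_segment.
Qed.

Lemma toric_boundary_row0 n (j : bool) f m :
  toric_boundary n (toric_row false f) m j =
  if toric_index m then
    if j then
      (-1) ^ n *:
        (m.2%:~R *: f (m.1 + 1, m.2) - m.1%:~R *: f (m.1, m.2 + 1))
    else sing_boundary (f m)
  else 0.
Proof.
rewrite /toric_boundary /toric_row; case: ifP => // _.
by case: j => /=; [rewrite raddf0 add0r|rewrite addr0].
Qed.

Lemma toric_boundary_row1 n (j : bool) f m :
  toric_boundary n (toric_row true f) m j =
  if toric_index m && j then sing_boundary (f m) else 0.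
Proof.
rewrite /toric_boundary /toric_row; case: ifP => //= _.
case: j => /=; first by rewrite !scaler0 subr0 scaler0 addr0.
by rewrite raddf0 addr0.
Qed.

Lemma toric_boundaryD n (x y : toric_family R) :
  toric_boundary n (x + y) = toric_boundary n x + toric_boundary n y.
Proof. exact: raddfD. Qed.

Lemma toric_boundaryB n (x y : toric_family R) :
  toric_boundary n (x - y) = toric_boundary n x - toric_boundary n y.
Proof. exact: toric_boundary_is_zmod_morphism. Qed.

(* Two passes of the cone operators: the first pushes the e_0 components below
   level d at the cost of changing the e_1 components, the second treats the
   latter, where the augmentation vanishes for parity reasons. *)
Lemma toric_boundary_modulo d b (k : int) x :
    x \in chains b (2 * k + 1) ->
    toric_boundary (2 * k + 1) x \in chains d (2 * k + 1 - 1) ->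
    (forall m, toric_index m -> below d m = set0 -> augmentation (x m false) = 0) ->
  exists2 y, y \in chains b (2 * k + 1 + 1) &
    x - toric_boundary (2 * k + 1 + 1) y \in chains d (2 * k + 1).
Proof.
set n := 2 * k + 1 => xb dxd x0.
(* For [b <= d] the window is the zero complex and [x] already lies in level [d]. *)
have [bd|/ltW db] := leP b d.
  exists 0; first exact: rpred0.
  by rewrite raddf0 subr0; exact: (toric_chains_le bd).
pose p m := base_point d b m.
pose K m c := cone_chain (p m) c.
have supp (z : toric_family R) j : z \in chains b n ->
    toric_row j (fun m => K m (z m j)) \in chains b (n + 1).
  move=> zb; apply: toric_row_chains.
  - apply: sub_finite_set (toric_chains_finite zb) => m /= zm; exists j.
    by apply: contra_neq zm => ->; rewrite /K raddf0.
  - by move=> m mI; rewrite (toric_chains_index _ zb) // /K raddf0.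
  - move=> m mI; rewrite (_ : _ - _ = n + 1 - 2 * (m.1 + m.2) - j%:Z + 1).
      apply: cone_chains; last exact: toric_chains_sing.
      by move=> y l; exact: base_cone_high.
    by lia.
(* By the cone formula the difference is the cone of the boundary of [c] plus the augmentation times
   the apex. The cone stays below [d]; the apex does too unless nothing lies below [d], and then the
   augmentation is 0. *)
have homotopy m c i : sing_chains (i - 1) (below d m) (sing_boundary c) ->
    (below d m = set0 -> augmentation c = 0) -> (i != 0 -> augmentation c = 0) ->
    sing_chains i (below d m) (c - sing_boundary (K m c)).
  move=> cd c0 ci; rewrite sing_boundary_cone !opprB addrC addrA subrK.
  apply: sing_chainsD; last first.
    rewrite -[i](subrK 1).
    by apply: cone_chains => // y l; exact: base_cone_low.
  have [->|/ci ->] := eqVneq i 0; last first.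
    by rewrite scale0r; exact: sing_chains0.
  have [pd|pd] := pselect (below d m (p m)).
    by apply: sing_chainsZ; exact: point_chains.
  rewrite c0 ?scale0r; first exact: sing_chains0.
  apply/eqP; apply: contra_notT pd => /set0P ne.
  by have := @base_point_low d b m; rewrite min_l //; exact.
have dd y : toric_boundary n (toric_boundary (n + 1) y) = 0 :> toric_family R.
  by rewrite -{1}[n](addrK 1) toric_boundaryK.
have nb y : y \in chains b (n + 1) -> toric_boundary (n + 1) y \in chains b n.
  by move=> yb; have := toric_boundary_chains yb; rewrite addrK.
pose y0 : toric_family R := toric_row false (fun m => K m (x m false)).
have y0b : y0 \in chains b (n + 1) by exact: supp.
pose x' := x - toric_boundary (n + 1) y0.
have x'b : x' \in chains b n by rewrite rpredB // nb.
pose v : toric_family R := toric_row false (fun m => x' m false).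
have vd : v \in chains d n.
  apply: toric_row_chains.
  - by apply: sub_finite_set (toric_chains_finite x'b) => m; exists false.
  - by move=> m mI; rewrite (toric_chains_index _ x'b).
  - move=> m mI; have -> : x' m false = x m false - sing_boundary (K m (x m false)).
      by rewrite /x' [LHS](_ : _ = x m false - toric_boundary (n + 1) y0 m false)
        // toric_boundary_row0 mI.
    apply: homotopy; first last.
    + by move=> i0; exact: (augmentation_dim i0 (toric_chains_sing xb m false)).
    + exact: x0.
    + have := toric_chains_sing dxd m false.
      rewrite /toric_boundary mI [X in sing_chains _ _ X]addr0.
      rewrite (_ : n - 1 + 1 - _ - _ =
        n + 1 - 2 * (m.1 + m.2) - false%:Z - 1); last by clear; lia.
      exact.
(* Removing the [e_0] part, now below level [d], leaves a family whose boundary in the [e_1]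
   components is purely singular. *)
pose u := x' - v.
have ub : u \in chains b n by rewrite rpredB // (toric_chains_le db vd).
have u0 m : u m false = 0.
  by rewrite [LHS](_ : _ = x' m false - x' m false) // subrr.
have dud : toric_boundary n u \in chains d (n - 1).
  have -> : toric_boundary n u = toric_boundary n x - toric_boundary n v.
    by rewrite /u toric_boundaryB /x' toric_boundaryB dd subr0.
  by apply: rpredB => //; exact: toric_boundary_chains.
pose y1 : toric_family R := toric_row true (fun m => K m (u m true)).
have y1b : y1 \in chains b (n + 1) by exact: supp.
exists (y0 + y1); first exact: rpredD.
have -> : x - toric_boundary (n + 1) (y0 + y1) =
    v + (u - toric_boundary (n + 1) y1).
  by rewrite toric_boundaryD opprD addrA /u addrA (addrC v) subrK.
apply: rpredD => //; set w := u - _.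
have wb : w \in chains b n by rewrite rpredB // nb.
apply/asboolP; split; first exact: toric_chains_finite wb.
  by move=> m j mI; exact: toric_chains_index wb mI.
move=> m j mI.
have -> : w m j = u m j - toric_boundary (n + 1) y1 m j by [].
rewrite toric_boundary_row1 mI /=; case: j; last first.
  by rewrite u0 [X in sing_chains _ _ X]subr0; exact: sing_chains0.
(* In total degree [2 * k + 1] the [e_1] components have odd dimension, hence contain no
   0-simplices. *)
have aug0 : augmentation (u m true) = 0.
  have odd_dim : n + 1 - 2 * (m.1 + m.2) - true%:Z != 0 by rewrite /n; clear; lia.
  exact: augmentation_dim odd_dim (toric_chains_sing ub m true).
apply: homotopy => //.
have := toric_chains_sing dud m true.
rewrite /toric_boundary mI !u0 !scaler0 subrr scaler0 [X in sing_chains _ _ X]addr0.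
rewrite (_ : n - 1 + 1 - _ - _ = n + 1 - 2 * (m.1 + m.2) - true%:Z - 1); last first.
  by clear; lia.
exact.
Qed.

(** Points weighted by [z] form the [e_0] part; cones in the [e_1] part cancel the resulting
    boundary up to its augmentation times an apex. This remainder vanishes where the relation on [z]
    holds and lies below [d] elsewhere. *)
Lemma toric_cycle_modulo d b (k : int) (z : int * int -> rat) :
    finite_set [set m | z m != 0] ->
    (forall m, z m != 0 ->
       [/\ toric_index m, m.1 + m.2 = k + 1 & below b m !=set0]) ->
    (forall m, toric_index m -> m.1 + m.2 = k ->
       below (Order.min d b) m !=set0 \/
       m.2%:~R * z (m.1 + 1, m.2) = m.1%:~R * z (m.1, m.2 + 1)) ->
  exists x, [/\ x \in chains b (2 * k + 1),
    toric_boundary (2 * k + 1) x \in chains d (2 * k + 1 - 1) &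
    forall m, augmentation (x m false) = z m].
Proof.
set n := 2 * k + 1 => zfin zI zd.
pose p m := base_point d b m.
pose x0 m := z m *: point_chain (p m).
pose w m := m.2%:~R *: x0 (m.1 + 1, m.2) - m.1%:~R *: x0 (m.1, m.2 + 1).
(* The sign makes the boundary of the cone cancel the term [(-1) ^ n *: w m] of the toric
   boundary. *)
pose x1 m := if toric_index m then - (-1) ^ n *: cone_chain (p m) (w m) else 0.
have x0b : toric_row false x0 \in chains b n.
  apply: toric_row_chains.
  - apply: sub_finite_set zfin => m /=.
    by apply: contra_neq => zm; rewrite /x0 zm scale0r.
  - move=> m; apply: contraNeq => x0m.
    suff /zI[] : z m != 0 by [].
    by apply: contra_neq x0m => zm; rewrite /x0 zm scale0r.
  - move=> m mI; have [zm|/zI[_ mk bm]] := eqVneq (z m) 0.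
      by rewrite /x0 zm scale0r; exact: sing_chains0.
    rewrite (_ : n + 1 - _ - _ = 0); last by rewrite /n; lia.
    by apply: sing_chainsZ; apply: point_chains; exact: base_point_high.
have dx0b := toric_boundary_chains x0b.
have wE m : toric_index m ->
    w m = (-1) ^ n *: toric_boundary n (toric_row false x0) m true.
  move=> mI; rewrite toric_boundary_row0 mI scalerA -expfzMl mulrNN mulr1.
  by rewrite exp1rz scale1r.
have x1b : toric_row true x1 \in chains b n.
  apply: toric_row_chains.
  - apply: sub_finite_set (toric_chains_finite dx0b) => m /=; rewrite /x1.
    case: ifP => [mI|]; last by rewrite eqxx.
    move=> x1m; exists true; apply: contra_neq x1m => dx0.
    by rewrite wE // dx0 scaler0 raddf0 scaler0.
  - by move=> m mI; rewrite /x1 (negbTE mI).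
  - move=> m mI; rewrite /x1 mI; apply: sing_chainsZ.
    rewrite (_ : n + 1 - _ - _ =
      n - 1 + 1 - 2 * (m.1 + m.2) - true%:Z + 1); last by lia.
    apply: cone_chains => [y l|]; first exact: base_cone_high.
    by rewrite wE //; apply: sing_chainsZ; exact: toric_chains_sing.
exists (toric_row false x0 + toric_row true x1); split; first exact: rpredD.
- set x := _ + _; have xb : x \in chains b n by exact: rpredD.
  have dxb := toric_boundary_chains xb.
  apply/asboolP; split; first exact: toric_chains_finite dxb.
    by move=> m j mI; exact: toric_chains_index dxb mI.
  move=> m j mI.
  have -> : toric_boundary n x m j =
      toric_boundary n (toric_row false x0) m j +
      toric_boundary n (toric_row true x1) m j.
    by rewrite toric_boundaryD.
  rewrite toric_boundary_row0 toric_boundary_row1 mI /=; case: j; last first.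
    rewrite [X in sing_chains _ _ X]addr0 sing_boundaryZ sing_boundaryU !scaler0.
    exact: sing_chains0.
  rewrite -/(w m) /x1 mI sing_boundaryZ sing_boundary_cone scaleNr -scalerBr.
  apply: sing_chainsZ; rewrite opprB.
  have -> : sing_boundary (w m) = 0.
    by rewrite raddfB /= !sing_boundaryZ !sing_boundaryU !scaler0 subrr.
  rewrite [cone_chain _ 0]raddf0 subr0 addrCA subrr addr0.
  have -> : augmentation (w m) =
      m.2%:~R * z (m.1 + 1, m.2) - m.1%:~R * z (m.1, m.2 + 1).
    by rewrite raddfB /= !augmentationZ !augmentation_point !mulr1.
  set e := _ * _ - _; have [->|e0] := eqVneq e 0.
    by rewrite scale0r; exact: sing_chains0.
  (* A nonzero remainder requires [z] to be nonzero at a neighbour of [m]; the remainder is then of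
     dimension 0, as a multiple of a point must be. *)
  have mk : m.1 + m.2 = k.
    have [z1|/zI[_ + _]] := eqVneq (z (m.1 + 1, m.2)) 0; last by rewrite /=; lia.
    have [z2|/zI[_ + _]] := eqVneq (z (m.1, m.2 + 1)) 0; last by rewrite /=; lia.
    by move: e0; rewrite /e z1 z2 !mulr0 subrr eqxx.
  rewrite (_ : n - 1 + 1 - _ - _ = 0); last by rewrite /n; lia.
  apply: sing_chainsZ; apply: point_chains.
  have [/base_point_low|zE] := zd m mI mk; last first.
    by move: e0; rewrite /e zE subrr eqxx.
  by apply: outer_below_le; rewrite ge_min lexx.
- move=> m.
  have -> : (toric_row false x0 + toric_row true x1) m false = x0 m + 0 by [].
  by rewrite addr0 augmentationZ augmentation_point mulr1.
Qed.

End ToricChains.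

Lemma homology_map_pi (C D : chain_complex) (f : chain_map C D) n
    (c : subgroup (@cycles C n)) :
  homology_map f n (\pi_(homology C n)%qT c) =
  \pi_(homology D n)%qT (subgroup_map (@cmap_cycles _ _ f n) c).
Proof. exact: quot_map_pi. Qed.

(** * Homology classes of windows through representing families *)

Section WindowClasses.
Variables (R : realType) (Omega : set 'rV[R]_2) (n : int).

Local Notation chains := (toric_chains Omega).
Local Notation window := (toric_window Omega).

Lemma quot_eq0 (W : zmodType) (S : zmodClosed W) (w : W) :
  (\pi_(Quotient.quot S)%qT w == 0) = (w \in S).
Proof.
by rewrite -[0](raddf0 (\pi_(Quotient.quot S)%qT)) -Quotient.idealrBE subr0.
Qed.

Definition window_class d b x (xb : x \in chains b n) : window d b n :=
  \pi_(Quotient.quot (@toric_level R Omega d b n))%qT (Subgroup xb).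

Lemma window_diff d b i j (x : toric_complex Omega b i) :
  cdiff (window d b) i j (\pi_(Quotient.quot (@toric_level R Omega d b i))%qT x) =
  \pi_(Quotient.quot (@toric_level R Omega d b j))%qT
    (cdiff (toric_complex Omega b) i j x).
Proof. exact: quot_map_pi. Qed.

Lemma window_class_cycle d b x (xb : x \in chains b n) :
  (window_class d xb \in @cycles (window d b) n) =
  (toric_boundary n x \in chains d (n - 1)).
Proof.
rewrite unfold_in /cycles /window_class window_diff quot_eq0 unfold_in /=.
by rewrite /toric_level /= /toric_diff_family subrK eqxx.
Qed.

(** The representative lives in the ambient group of families, so the same [x] can be followed
    through all levels and both quotients are handled only here. *)
Definition represents d b (h : homology (window d b) n) (x : toric_family R) :=
  exists (xb : x \in chains b n)
    (xc : window_class d xb \in @cycles (window d b) n),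
    h = \pi_(homology (window d b) n)%qT (Subgroup xc).

Lemma represents_exists d b (h : homology (window d b) n) :
  exists x, represents h x.
Proof.
case hE : (repr h) => [c cc].
case cE : (repr c) => [x xb].
have ccE : window_class d xb = c by rewrite /window_class -cE reprK.
have xc : window_class d xb \in @cycles (window d b) n by rewrite ccE.
exists x, xb, xc; rewrite -[h]reprK hE; congr (\pi_ _ _)%qT.
by apply: val_inj; rewrite /= ccE.
Qed.

Lemma represents_intro d b x : x \in chains b n ->
    toric_boundary n x \in chains d (n - 1) ->
  exists h : homology (window d b) n, represents h x.
Proof.
move=> xb; rewrite -(window_class_cycle d xb) => xc.
by exists (\pi_(homology (window d b) n)%qT (Subgroup xc)), xb, xc.
Qed.

Lemma represents_chains d b (h : homology (window d b) n) x :
  represents h x -> x \in chains b n /\ toric_boundary n x \in chains d (n - 1).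
Proof. by move=> [xb [xc _]]; split=> //; rewrite -(window_class_cycle d xb). Qed.

(** Unfolding both quotients turns vanishing into being a boundary modulo level [d], the form in
    which the cone argument delivers it. *)
Lemma represents_eq0 d b (h : homology (window d b) n) x : represents h x ->
  h = 0 <-> exists2 y, y \in chains b (n + 1) &
              x - toric_boundary (n + 1) y \in chains d n.
Proof.
move=> [xb [xc ->]]; split.
  move/eqP; rewrite quot_eq0 => /asboolP[c]; case cE : (repr c) => [y yb] /=.
  move=> cx; exists y => //.
  move/eqP: cx; rewrite -[c]reprK cE window_diff eq_sym -Quotient.idealrBE.
  by rewrite unfold_in /= /toric_level /= /toric_diff_family eqxx.
move=> [y yb xy]; apply/eqP; rewrite quot_eq0; apply/asboolP.
exists (\pi_(Quotient.quot (@toric_level R Omega d b (n + 1)))%qT (Subgroup yb)).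
rewrite window_diff; apply/eqP; rewrite eq_sym -Quotient.idealrBE.
by rewrite unfold_in /= /toric_level /= /toric_diff_family eqxx.
Qed.

Lemma represents_map d b d' b' (dd' : (d <= d')%E) (bb' : (b <= b')%E)
    (h : homology (window d b) n) x : represents h x ->
  represents (homology_map (window_map Omega dd' bb') n h) x.
Proof.
move=> [xb [xc ->]]; have xb' := toric_chains_le bb' xb.
have xc' : window_class d' xb' \in @cycles (window d' b') n.
  by move: xc; rewrite !window_class_cycle; exact: toric_chains_le.
exists xb', xc'; rewrite homology_map_pi; congr (\pi_ _ _)%qT.
apply: val_inj; rewrite /= /window_class [LHS]quot_map_pi; congr (\pi_ _ _)%qT.
exact: val_inj.
Qed.

Lemma representsB d b (h h' : homology (window d b) n) x x' :
  represents h x -> represents h' x' -> represents (h - h') (x - x').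
Proof.
move=> [xb [xc ->]] [xb' [xc' ->]].
have xxb : x - x' \in chains b n by exact: rpredB.
have xxE : window_class d xxb = window_class d xb - window_class d xb'.
  rewrite /window_class -raddfB; congr (\pi_ _ _)%qT.
  exact: val_inj.
have xxc : window_class d xxb \in @cycles (window d b) n.
  by rewrite xxE; exact: rpredB xc xc'.
exists xxb, xxc; rewrite -raddfB; congr (\pi_ _ _)%qT.
by apply: val_inj; rewrite /= xxE.
Qed.

End WindowClasses.

(** * The complement of a star domain and linear forms on it *)

Section Geometry.
Variables (R : realType) (Omega : set 'rV[R]_2).

Local Notation plane := 'rV[R]_2.
Local Notation below := (outer_below Omega).

Lemma plane_eqP (u v : plane) : u 0 0 = v 0 0 -> u 0 1 = v 0 1 -> u = v.
Proof.
move=> uv0 uv1; apply/rowP => -[[|[|//]] jP].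
  by rewrite (_ : Ordinal jP = 0) //; exact: val_inj.
by rewrite (_ : Ordinal jP = 1) //; exact: val_inj.
Qed.

(** The intermediate value theorem for the cosine gives the angle; the second coordinate is then
    fixed by its square and its sign. *)
Lemma quarter_circle_angle (z : plane) : quarter_circle z ->
  exists2 theta, 0 <= theta <= pi / 2 &
    z = \row_j (if j == 0 then cos theta else sin theta).
Proof.
move=> [[z0 z1] zE]; have pi0 := @pi_gt0 R.
have zle1 : z 0 0 <= 1.
  rewrite -(@ler_pXn2r _ 2) ?nnegrE // expr1n -zE lerDl; exact: sqr_ge0.
have [|||theta] := @IVT R cos 0 (pi / 2) (z 0 0).
- by rewrite divr_ge0 // ltW.
- exact/continuous_subspaceT/continuous_cos.
- by rewrite cos0 cos_pihalf min_r ?max_l ?ler01 // z0 zle1.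
rewrite in_itv /= => /andP[t0 t1] tE; exists theta; first by rewrite t0.
have s0 : 0 <= sin theta by apply: sin_ge0_pi; rewrite t0 /=; lra.
apply: plane_eqP; rewrite mxE //=.
have : sin theta ^+ 2 = z 0 1 ^+ 2.
  by have := cos2Dsin2 theta; rewrite tE -zE => /addrI.
by move=> /eqP; rewrite eqrXn2 // => /eqP.
Qed.

(** The radius, as a function of the angle, is continuous on a compact interval. Its minimum is
    attained, hence positive. *)
Lemma star_domain_radius : star_domain Omega ->
  exists r : plane -> R, exists c M : R,
    [/\ 0 < c, forall z, quarter_circle z -> c <= r z <= M &
      Omega = [set v | exists t z,
        [/\ quarter_circle z, 0 <= t <= r z & v = t *: z]]].
Proof.
move=> [r [[F Fd FE] r0 OmegaE]].
have Fc : {within `[0, pi / 2], continuous F}.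
  apply: continuous_subspaceT => x.
  by apply: differentiable_continuous; apply/derivable1_diffP; exact: (Fd 0%N).
have pi0 : 0 <= pi / 2 :> R by rewrite divr_ge0 // ltW // pi_gt0.
have [a aI amin] := EVT_min pi0 Fc.
have [b bI bmax] := EVT_max pi0 Fc.
exists r, (F a), (F b); split=> //.
- have aI' : 0 <= a <= pi / 2 by move: aI; rewrite in_itv.
  rewrite -FE //; apply: r0; split; last by rewrite !mxE /= cos2Dsin2.
  move/andP: aI' => [a0 a1]; have pipos := @pi_gt0 R; split; rewrite mxE /=.
    by apply: cos_ge0_pihalf; rewrite a1 andbT; lra.
  by apply: sin_ge0_pi; rewrite a0 /=; lra.
- move=> z /quarter_circle_angle[theta tI ->]; rewrite FE //.
  by rewrite amin ?bmax // in_itv.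
Qed.

(** [c] and [M] bound the radius from below and above. On the quadrant the coordinate sum dominates
    the norm, and the norm dominates each coordinate. *)
Lemma star_domain_outer : star_domain Omega -> exists c M : R,
  [/\ 0 < c, forall v, outer Omega v -> c <= v 0 0 + v 0 1 &
    forall v : plane, 0 < v 0 0 -> 0 < v 0 1 -> M < v 0 0 \/ M < v 0 1 ->
      outer Omega v].
Proof.
move=> /star_domain_radius[r [c [M [c0 rcM OmegaE]]]].
exists c, M; split=> //.
- move=> v [[v0 v1] vO]; rewrite leNgt; apply/negP => vc; apply: vO.
  rewrite OmegaE /=; set q := v 0 0 ^+ 2 + v 0 1 ^+ 2.
  have q0 : 0 < q by rewrite addr_gt0 // exprn_gt0.
  have sq0 : 0 < Num.sqrt q by rewrite sqrtr_gt0.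
  have sqE : Num.sqrt q ^+ 2 = q by rewrite sqr_sqrtr // ltW.
  have zQ : quarter_circle ((Num.sqrt q)^-1 *: v).
    split; first by split; rewrite mxE mulr_ge0 // ?invr_ge0 ltW.
    by rewrite !mxE !exprMn -mulrDr exprVn sqE mulVf // gt_eqF.
  exists (Num.sqrt q), ((Num.sqrt q)^-1 *: v); split=> //; last first.
    by rewrite scalerA mulfV ?scale1r // gt_eqF.
  rewrite ltW //=; have /andP[cr _] := rcM _ zQ; apply: le_trans cr.
  apply: (@le_trans _ _ (v 0 0 + v 0 1)); last exact: ltW.
  rewrite -(@ler_pXn2r _ 2) ?nnegrE ?(ltW sq0) //; last by rewrite addr_ge0 // ltW.
  by rewrite sqE sqrrD /q lerD2r lerDl mulrn_wge0 // mulr_ge0 // ltW.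
- move=> v v0 v1 vM; split=> // vO; move: vO v0 v1 vM; rewrite OmegaE.
  move=> [t [z [zQ /andP[t0 tr] ->]]]; rewrite !mxE => _ _.
  have /andP[_ rM] := rcM _ zQ; case: zQ => -[z0 z1] zE.
  have tM : t <= M by exact: le_trans rM.
  have zle (x y : R) : x ^+ 2 + y ^+ 2 = 1 -> 0 <= x -> t * x <= M.
    move=> xy x0; apply: le_trans tM; rewrite ler_piMr //.
    rewrite -(@ler_pXn2r _ 2) ?nnegrE // expr1n -xy lerDl; exact: sqr_ge0.
  case; rewrite ltNge; first by rewrite (zle _ _ zE).
  by rewrite (zle _ (z 0 0)) // addrC.
Qed.

Lemma linform_continuous m1 m2 : continuous (@linform R m1 m2).
Proof.
have coordc i : continuous (fun v : plane => v 0 i) by exact: coord_continuous.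
move=> y; apply: (@cvgD _ _ _ (nbhs y) _ (fun v : plane => m1%:~R * v 0 0)
  (fun v : plane => m2%:~R * v 0 1)); apply: cvgMl_tmp; exact: coordc.
Qed.

(** One coefficient is positive and the other at most 0. A point with a small coordinate at the
    former and a coordinate beyond [M] at the latter is outside [Omega] and has value below [d]. *)
Lemma outer_below_boundary (m : int * int) (d : R) : star_domain Omega ->
  toric_index m -> ~~ ((1 <= m.1) && (1 <= m.2)) -> 0 < d ->
  below d%:E m !=set0.
Proof.
move=> /star_domain_outer[c [M [_ _ MU]]] mI m1 d0.
have small (q : int) : 0 < q -> exists2 e : R, 0 < e & q%:~R * e < d.
  move=> q0; have q0' : 0 < q%:~R + 1 :> R by rewrite addr_gt0 // ltr0z.
  (* The 1 added in the denominator makes the inequality strict. *)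
  exists (d / (q%:~R + 1)); first by rewrite divr_gt0.
  by rewrite mulrA ltr_pdivrMr // mulrC ltr_pM2l // ltrDl.
have L0 : 0 < `|M| + 1 by rewrite ltr_wpDl.
have ML : M < `|M| + 1 by rewrite (le_lt_trans (ler_norm M)) // ltrDl.
have neg (q : int) : q <= 0 -> q%:~R * (`|M| + 1) <= 0.
  by move=> q0; rewrite mulr_le0_ge0 ?(ltW L0) // lerz0.
have [m10|m10] := ltP 0 m.1.
  have [e e0 ed] := small _ m10; have m20 : m.2 <= 0 by lia.
  pose v : plane := \row_j (if j == 0 then e else `|M| + 1).
  have [v0 v1] : v 0 0 = e /\ v 0 1 = `|M| + 1 by rewrite !mxE.
  exists v; split; first by apply: MU; rewrite ?v0 ?v1 //; right.
  by rewrite lte_fin /linform v0 v1; have := neg _ m20; lra.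
have m20 : 0 < m.2 by move: mI; rewrite /toric_index; lia.
have [e e0 ed] := small _ m20.
pose v : plane := \row_j (if j == 0 then `|M| + 1 else e).
have [v0 v1] : v 0 0 = `|M| + 1 /\ v 0 1 = e by rewrite !mxE.
exists v; split; first by apply: MU; rewrite ?v0 ?v1 //; left.
by rewrite lte_fin /linform v0 v1; have := neg _ m10; lra.
Qed.

Lemma outer_closure_lower (A : plane -> R) (c : R) : continuous A ->
  (forall v, outer Omega v -> c <= A v) ->
  forall v, outer_closure Omega v -> c <= A v.
Proof.
move=> Ac cA v [vU _].
have cl : closed [set v | c <= A v].
  apply: (@preimage_closed _ _ A [set x | c <= x]) => [x _|]; first exact: Ac.
  exact: closed_ge.
by have := closure_subset cA vU; rewrite -(closure_id _).1.
Qed.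

Lemma outer_below_closure (m : int * int) (a : R) :
  (exists2 p, outer_closure Omega p & linform m.1 m.2 p < a) ->
  below a%:E m !=set0.
Proof.
move=> [p [pU _] pa].
have [|v [vU va]] := pU [set v | linform m.1 m.2 v < a].
  apply: (@linform_continuous m.1 m.2 p [set x | x < a]).
  by apply: open_nbhs_nbhs; split=> //; exact: open_lt.
by exists v; split=> //; rewrite lte_fin.
Qed.

Lemma outer_closure_min (m1 m2 : int) : star_domain Omega ->
  1 <= m1 -> 1 <= m2 ->
  exists x, is_min [set linform m1 m2 p | p in outer_closure Omega] x.
Proof.
move=> /star_domain_outer[c [M [_ _ MU]]] m1P m2P.
have L0 : 0 < `|M| + 1 by rewrite ltr_wpDl.
have ML : M < `|M| + 1 by rewrite (le_lt_trans (ler_norm M)) // ltrDl.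
pose p0 : plane := \row_j (`|M| + 1).
have [p00 p01] : p0 0 0 = `|M| + 1 /\ p0 0 1 = `|M| + 1 by rewrite !mxE.
have p0U : outer Omega p0 by apply: MU; rewrite ?p00 ?p01 //; left.
have p0C : outer_closure Omega p0.
  by split; [exact: subset_closure|rewrite /quadrant /= p00 p01 !(ltW L0)].
(* The closure is unbounded, but this truncation is compact: with coefficients at least 1, the form
   bounds both coordinates. A minimum on [B] is a minimum on the whole closure. *)
pose B := outer_closure Omega `&` [set v | linform m1 m2 v <= linform m1 m2 p0].
have m1R : 1 <= m1%:~R :> R by rewrite ler1z.
have m2R : 1 <= m2%:~R :> R by rewrite ler1z.
have Bc : compact B.
  apply: (@subclosed_compact _ _
    [set v : plane | forall i, v ord0 i \in `[0, linform m1 m2 p0]]).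
  - apply: closedI; last first.
      apply: (@preimage_closed _ _ (linform m1 m2)
                [set x | x <= linform m1 m2 p0]) => [x _|].
        exact: linform_continuous.
      exact: closed_le.
    apply: closedI; first exact: closed_closure.
    apply: closedI.
      apply: (@preimage_closed _ _ (fun v : plane => v 0 0)
                [set x | 0 <= x]) => [x _|].
        exact: coord_continuous.
      exact: closed_ge.
    apply: (@preimage_closed _ _ (fun v : plane => v 0 1)
              [set x | 0 <= x]) => [x _|].
      exact: coord_continuous.
    exact: closed_ge.
  - apply: (@rV_compact _ _ (fun=> `[0, linform m1 m2 p0]%classic)) => _.
    exact: segment_compact.
  - move=> v [[_ [v0 v1]] /= vle].
    have q0 : v 0 0 <= m1%:~R * v 0 0 by rewrite ler_peMl.
    have q1 : v 0 1 <= m2%:~R * v 0 1 by rewrite ler_peMl.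
    move=> [[|[|//]] iP]; rewrite in_itv /=.
      rewrite (_ : Ordinal iP = 0); last exact: val_inj.
      by rewrite v0 /=; apply: le_trans vle; rewrite /linform; lra.
    rewrite (_ : Ordinal iP = 1); last exact: val_inj.
    by rewrite v1 /=; apply: le_trans vle; rewrite /linform; lra.
have [|p /set_mem[pC ple] pmin] := EVT_min_rV _ Bc
    (continuous_subspaceT (@linform_continuous m1 m2)).
  by exists p0; split=> //=.
exists (linform m1 m2 p); split; first by exists p.
move=> _ [v vC <-]; have [vle|/ltW] := leP (linform m1 m2 v) (linform m1 m2 p0).
  by apply: pmin; apply/mem_set; split.
exact: le_trans.
Qed.

End Geometry.

(** * Vanishing and nonvanishing of the map to level infinity *)

Section Capacity.
Variables (R : realType) (Omega : set 'rV[R]_2) (k : nat).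
Hypothesis Omega_star : star_domain Omega.
Hypothesis Omega_concave : concave_domain Omega.

Local Notation below := (outer_below Omega).
Local Notation chains := (toric_chains Omega).

(** With coefficients at least 1 the form dominates the coordinate sum, which is bounded below on
    [outer Omega]; so one [c] serves all [m]. *)
Lemma outer_below_interior : exists2 c : R, 0 < c &
  forall m : int * int, 1 <= m.1 -> 1 <= m.2 ->
    (forall p, outer_closure Omega p -> c <= linform m.1 m.2 p) /\
    below c%:E m = set0.
Proof.
have [c [_ [c0 cU _]]] := star_domain_outer Omega_star.
exists c => // m m1 m2.
have m1R : 1 <= m.1%:~R :> R by rewrite ler1z.
have m2R : 1 <= m.2%:~R :> R by rewrite ler1z.
have cl p : outer Omega p -> c <= linform m.1 m.2 p.
  move=> pU; have [[/ltW p0 /ltW p1] _] := pU; apply: le_trans (cU _ pU) _.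
  by rewrite lerD // ler_peMl.
split; first exact: outer_closure_lower (@linform_continuous _ _ _) cl.
apply/seteqP; split=> // p [/cl cp]; rewrite lte_fin => pc.
by move: (lt_le_trans pc cp); rewrite ltxx.
Qed.

(* The relation between the augmentations at (j + 1, k - j) and (j, k + 1 - j)
   comes from the e_1 component of the boundary at (j, k - j). *)
Lemma augmentation_cycle (d : R) b x (j0 : nat) : 0 < d ->
    (forall m : int * int, 1 <= m.1 -> 1 <= m.2 -> below d%:E m = set0) ->
    x \in chains b (2 * k%:Z + 1) ->
    toric_boundary (2 * k%:Z + 1) x \in chains d%:E (2 * k%:Z + 1 - 1) ->
    (1 <= j0 <= k)%N ->
    augmentation (x (j0%:Z, (k.+1 - j0)%N%:Z) false) = 0 ->
  forall m, toric_index m -> below d%:E m = set0 -> augmentation (x m false) = 0.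
Proof.
move=> d0 dint xb dxd j0k zj0.
pose z j := augmentation (x (j%:Z, (k.+1 - j)%N%:Z) false).
have rel j : (1 <= j < k)%N -> (k - j)%N%:R * z j.+1 = j%:R * z j.
  move=> jk; pose m : int * int := (j%:Z, (k - j)%N%:Z).
  have mI : toric_index m by rewrite /toric_index /=; lia.
  have m0 : below d%:E m = set0 by apply: dint => /=; lia.
  have := sing_chains_set0 m0 (toric_chains_sing dxd m true).
  rewrite /toric_boundary mI => /(congr1 (@augmentation R _)).
  rewrite raddfD /= augmentation_boundary add0r augmentationZ raddf0.
  move=> /eqP; rewrite mulf_eq0 expfz_eq0 oppr_eq0 oner_eq0 andbF /=.
  rewrite raddfB /= !augmentationZ subr_eq0 => /eqP.
  rewrite /z subSS (_ : j%:Z + 1 = j.+1%:Z); last by lia.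
  by rewrite (_ : (k - j)%N%:Z + 1 = (k.+1 - j)%N%:Z) //; lia.
(* Both factors in [rel] are nonzero, so the [z j] vanish together. *)
have z1 j : (1 <= j <= k)%N -> (z j == 0) = (z 1%N == 0).
  elim: j => [//|[//|j] IHj] /andP[_ jk].
  rewrite -IHj; last by lia.
  have jk' : (1 <= j.+1 < k)%N by lia.
  have kj : (k - j.+1)%N%:R != 0 :> rat by rewrite pnatr_eq0; lia.
  have j1 : j.+1%:R != 0 :> rat by rewrite pnatr_eq0.
  have /(congr1 (eq_op^~ 0)) := rel _ jk'.
  by rewrite !mulf_eq0 (negbTE kj) (negbTE j1).
have z0 : z 1%N == 0 by rewrite -(z1 _ j0k); apply/eqP.
move=> m mI m0.
have /andP[m1 m2] : (1 <= m.1) && (1 <= m.2).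
  apply: contra_eqT m0 => mint; apply/set0P; exact: outer_below_boundary.
(* Off this antidiagonal the [e_0] component has nonzero dimension, hence augmentation 0. *)
have [mk|mk] := eqVneq (m.1 + m.2) (k%:Z + 1); last first.
  have dim0 : 2 * k%:Z + 1 + 1 - 2 * (m.1 + m.2) - false%:Z != 0.
    by move: mk; clear; lia.
  exact: augmentation_dim dim0 (toric_chains_sing xb m false).
have -> : m = (`|m.1|%N%:Z, (k.+1 - `|m.1|)%N%:Z).
  by case: m m1 m2 mk {mI m0} => a e /= *; congr (_, _); lia.
by apply/eqP; rewrite [_ == _]z1 //; lia.
Qed.

(** An empty sublevel set forces the component of a representative there to be 0, hence all relevant
    augmentations, and the class bounds at level infinity. *)
Lemma positive_homology_map_vanish (a : \bar R) (j0 : nat) :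
    (1 <= j0 <= k)%N -> below a (j0%:Z, (k.+1 - j0)%N%:Z) = set0 ->
  ~ positive_homology_map_neq0 Omega (2 * k%:Z + 1) a.
Proof.
move=> j0k a0 [h hP]; apply; apply: functional_extensionality_dep => d.
have [c c0 cint] := outer_below_interior.
(* Below [c] all sublevel sets with positive indices are empty. Compatibility of the family recovers
   the class at [d] from the one at this smaller level. *)
have e0 : 0 < Num.min d%:num c by rewrite lt_min c0 andbT.
pose e : {posnum R} := PosNum e0.
have ed : (e%:num%:E <= d%:num%:E)%E by rewrite lee_fin ge_min lexx.
have ec : (e%:num%:E <= c%:E)%E by rewrite lee_fin ge_min lexx orbT.
rewrite /positive_homology_map -(hP _ _ ed).
have [x xh] := represents_exists (h e).
have xd := represents_map ed (lexx a) xh.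
have xoo := represents_map (lexx _) (leey a) xd.
apply/(represents_eq0 xoo).
have [xa dxe] := represents_chains xh.
have xoob : x \in chains +oo%E (2 * k%:Z + 1) := toric_chains_le (leey a) xa.
have [|y yb xy] := toric_boundary_modulo Omega_concave xoob dxe.
  apply: (@augmentation_cycle e%:num +oo%E x j0) => //; last first.
    by rewrite (sing_chains_set0 a0 (toric_chains_sing xa _ false)) raddf0.
    move=> m m1 m2; rewrite -subset0 => p /(outer_below_le ec).
    by have [_ ->] := cint m m1 m2.
by exists y => //; exact: (toric_chains_le ed xy).
Qed.

Definition cycle_weight (m : int * int) : rat :=
  if [&& 1 <= m.1, 1 <= m.2 & m.1 + m.2 == k%:Z + 1]
  then ((`|m.1|.-1)`! * (`|m.2|.-1)`!)%N%:R else 0.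

Lemma cycle_weight_finite : finite_set [set m | cycle_weight m != 0].
Proof.
apply: (@sub_finite_set _ _ ((fun j : nat => (j%:Z, k%:Z + 1 - j%:Z)) @` `I_k.+1)).
  move=> [m1 m2] /=; rewrite /cycle_weight /=; case: ifP; last by rewrite eqxx.
  move=> /and3P[m1P m2P /eqP mk] _; exists `|m1|%N; first by rewrite /=; lia.
  by congr (_, _); lia.
by apply: finite_image; exact: finite_II.
Qed.

(** Both sides equal the product of the factorials of [m.1] and [m.2]. *)
Lemma cycle_weight_rel (m : int * int) : 1 <= m.1 -> 1 <= m.2 ->
  m.1 + m.2 = k%:Z ->
  m.2%:~R * cycle_weight (m.1 + 1, m.2) = m.1%:~R * cycle_weight (m.1, m.2 + 1).
Proof.
case: m => [[[|p]|//] [[|q]|//]] //= _ _ pqk.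
rewrite /cycle_weight !ifT /=; [|lia|lia].
rewrite !addn1 /= -!pmulrn -!natrM; congr (_%:R); rewrite !factS; lia.
Qed.

(** For each [delta] a relative cycle with augmentations [cycle_weight] is chosen. Two choices
    differ by a family of augmentation 0, hence by a boundary, so the classes are compatible. *)
Lemma positive_homology_map_nonzero (a : R) : (1 <= k)%N -> 0 < a ->
    (forall j, (1 <= j <= k)%N -> below a%:E (j%:Z, (k.+1 - j)%N%:Z) !=set0) ->
  positive_homology_map_neq0 Omega (2 * k%:Z + 1) a%:E.
Proof.
move=> k1 a0 a1.
have /choice[x xP] : forall d : {posnum R}, exists x,
    [/\ x \in chains a%:E (2 * k%:Z + 1),
      toric_boundary (2 * k%:Z + 1) x \in chains d%:num%:E (2 * k%:Z + 1 - 1) &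
      forall m, augmentation (x m false) = cycle_weight m].
  move=> d; apply: toric_cycle_modulo => //; first exact: cycle_weight_finite.
    move=> m; rewrite /cycle_weight; case: ifP; last by rewrite eqxx.
    move=> /and3P[m1 m2 /eqP mk] _; split=> //.
      by rewrite /toric_index; lia.
    have -> : m = (`|m.1|%N%:Z, (k.+1 - `|m.1|)%N%:Z).
      by case: m m1 m2 mk => ? ? /= *; congr (_, _); lia.
    by apply: a1; lia.
  move=> m mI mk; have [/andP[m1 m2]|mint] := boolP ((1 <= m.1) && (1 <= m.2)).
    by right; exact: cycle_weight_rel.
  left; rewrite -EFin_min; apply: outer_below_boundary => //.
  by rewrite lt_min a0 andbT.
have hex (d : {posnum R}) :
    exists h : homology (toric_window Omega d%:num%:E a%:E) (2 * k%:Z + 1),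
      represents h (x d).
  by have [xa dxd _] := xP d; exact: represents_intro.
pose h d := projT1 (cid (hex d)).
have hP d : represents (h d) (x d) := projT2 (cid (hex d)).
exists h.
  move=> d d' dd'; apply/eqP; rewrite -subr_eq0; apply/eqP.
  have xx := representsB (represents_map dd' (lexx _) (hP d)) (hP d').
  apply/(represents_eq0 xx); have [xxa dxx] := represents_chains xx.
  have [|y ya xy] := toric_boundary_modulo Omega_concave xxa dxx.
    move=> m _ _; have [_ _ xw] := xP d; have [_ _ xw'] := xP d'.
    by rewrite [X in augmentation X](_ : _ = x d m false - x d' m false) //
      raddfB /= xw xw' subrr.
  by exists y.
have [c c0 cint] := outer_below_interior.
pose e : {posnum R} := PosNum c0.
move=> /(congr1 (@^~ e)); rewrite /positive_homology_map.
have xoo := represents_map (lexx _) (leey a%:E) (hP e).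
move=> /(represents_eq0 xoo)[y yoo xy].
(* Nothing lies below [c] at this index, so if the class vanished, the augmentation there would be
   that of a singular boundary, namely 0; but the weight is a product of factorials. *)
pose m : int * int := (1, k%:Z).
have mI : toric_index m by [].
have m0 : below c%:E m = set0 by have [||_ ->] := cint m.
have := sing_chains_set0 m0 (toric_chains_sing xy m false).
rewrite [LHS](_ : _ = x e m false - toric_boundary (2 * k%:Z + 1 + 1) y m false) //.
rewrite /toric_boundary mI [X in _ - X]addr0 => /(congr1 (@augmentation R _)).
rewrite raddfB /= augmentation_boundary subr0 raddf0.
have [_ _ ->] := xP e; rewrite /cycle_weight ifT /=; last by lia.
by move=> /eqP; rewrite pnatr_eq0 -leqn0 leqNgt muln_gt0 !fact_gt0.
Qed.

End Capacity.

(** * The capacity as the largest of the minima *)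

Theorem proposition3p4 (R : realType) (Omega : set 'rV[R]_2) (k : nat) :
  star_domain Omega -> concave_domain Omega -> (1 <= k)%N ->
  exists mu : nat -> R,
    (forall j : nat, (1 <= j <= k)%N ->
       is_min [set linform j%:Z (k.+1 - j)%N%:Z p | p in outer_closure Omega]
         (mu j)) /\
    capacity Omega k = (\big[Num.max/mu 1%N]_(1 <= j < k.+1) mu j)%:E.
Proof.
move=> Ostar Oconcave k1.
have /choice[mu muP] : forall j : nat, exists x, (1 <= j <= k)%N ->
    is_min [set linform j%:Z (k.+1 - j)%N%:Z p | p in outer_closure Omega] x.
  move=> j; have [jk|jk] := boolP (1 <= j <= k)%N; last by exists 0.
  have [||x xP] := @outer_closure_min _ _ j%:Z (k.+1 - j)%N%:Z Ostar; [lia|lia|].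
  by exists x.
exists mu; split=> //.
have [c c0 cint] := outer_below_interior Ostar.
have mu_lt j (a : R) : (1 <= j <= k)%N -> mu j < a ->
    outer_below Omega a%:E (j%:Z, (k.+1 - j)%N%:Z) !=set0.
  move=> jk mua; apply: outer_below_closure => /=.
  by have [[p pC pE] _] := muP j jk; exists p; rewrite ?pE.
have mu_ge j (a : R) : (1 <= j <= k)%N -> a <= mu j ->
    outer_below Omega a%:E (j%:Z, (k.+1 - j)%N%:Z) = set0.
  move=> jk mua; apply/seteqP; split=> // p [pU]; rewrite lte_fin /= => pa.
  have [_ mulb] := muP j jk.
  have : mu j <= linform j%:Z (k.+1 - j)%N%:Z p.
    apply: mulb; exists p => //; split; first exact: subset_closure.
    by case: pU => -[p0 p1] _; split; exact: ltW.
  by move=> /(le_trans mua); rewrite leNgt pa.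
set B := \big[_/_]_(_ <= _ < _) _.
have B_ge j : (1 <= j <= k)%N -> mu j <= B.
  by move=> jk; apply: le_bigmax_seq => //; rewrite mem_index_iota.
(* Needed because the infimum defining the capacity ranges over positive levels only. *)
have mu1 : 0 < mu 1%N.
  have [[p pC <-] _] := muP 1%N k1; apply: lt_le_trans c0 _.
  have [||cl _] := cint (1, k%:Z) => //.
  by have := cl p pC; rewrite /= subSS subn0.
(* The starting value [mu 1] of the maximum is itself one of the candidates, since [1 <= k]. *)
have [j jk Bj] : exists2 j, (1 <= j <= k)%N & B = mu j.
  rewrite /B big_seq; elim/big_ind: _ => [|x y [i ik ->] [j jk ->]|j].
  - by exists 1%N.
  - by rewrite /Num.max; case: ifP => _; [exists j|exists i].
  - by rewrite mem_index_iota => jk; exists j.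
apply/eqP; rewrite eq_le; apply/andP; split.
  (* [B] itself is not an admissible level, the sublevel set of the maximal index being empty there,
     so the bound is obtained from [B + e] for every positive [e]. *)
  apply/lee_addgt0Pr => e e0; rewrite -EFinD; apply: ereal_inf_lbound.
  have Be : 0 < B + e.
    by rewrite addr_gt0 //; exact: lt_le_trans mu1 (B_ge 1%N k1).
  exists (B + e) => //; split=> //; apply: positive_homology_map_nonzero => // i ik.
  by apply: mu_lt => //; rewrite (le_lt_trans (B_ge i ik)) // ltrDl.
apply/ereal_infP => _ [a [a0 neq0] <-]; rewrite lee_fin leNgt; apply/negP => aB.
move: neq0; apply: (positive_homology_map_vanish Ostar Oconcave jk).
by apply: mu_ge => //; rewrite -Bj ltW.
Qed.
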